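(* Let $(\gamma,\beta)\in(0,1)^2$ be such that $2\gamma+\beta<1$. There exists a constant $c(\gamma,\beta)>0$, depending only on $\gamma$ and $\beta$, such that for every $\alpha>0$, every integer $n\ge 1$ and every integer $d\ge 2$, $$\frac{\rho_n^*\left(\mathcal D,\alpha,\gamma,\beta,\mathbf 1_{[0,1]}\right)}{d^{1/2}}\ \ge\ c(\gamma,\beta)\left(\left[(n z_\alpha^2)^{-1/2}d^{1/4}\wedge d^{-1/2}(\log d)^{-1/2}\right]\vee\left(n^{-1/2}d^{-1/4}\right)\right),$$ where $z_\alpha=e^{2\alpha}-e^{-2\alpha}$ and $\rho_n^*(\mathcal D,\alpha,\gamma,\beta,\mathbf 1_{[0,1]})$ is the $\alpha$-private minimax separation rate over the class $\mathcal D$ of piecewise constant densities on $d$ equal intervals, for non-interactive channels and for the null density $f_0=\mathbf 1_{[0,1]}$.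
   Context: Notation: $a\wedge b=\min(a,b)$, $a\vee b=\max(a,b)$; $\|\cdot\|_2$ is the norm of $\mathbb L_2([0,1])$ (Lebesgue measure). Non-interactive local differential privacy. $X_1,\dots,X_n$ are i.i.d. with values in $[0,1]$ and density $f$. A non-interactive $\alpha$-private channel $Q$ is given by Markov kernels (conditional distributions) $Q_1,\dots,Q_n$, where $Q_i(\cdot\mid x)$, $x\in[0,1]$, is a probability measure on a measurable space $(\tilde\Omega_i,\mathcal Z_i)$, satisfying for all $1\le i\le n$ $$\sup_{S\in\mathcal Z_i,\ (x,x')\in[0,1]^2}\frac{Q_i(Z_i\in S\mid X_i=x)}{Q_i(Z_i\in S\mid X_i=x')}\le e^{\alpha}.$$ $\mathcal Q_\alpha$ is the set of such channels. For a density $f$, $\mathbb P_{Q^n_f}$ is the law of the observed private views $(Z_1,\dots,Z_n)$: $\mathbb P_{Q^n_f}((Z_1,\dots,Z_n)\in\prod_i S_i)=\prod_{i=1}^n\int Q_i(Z_i\in S_i\mid X_i=x)f(x)\,dx$. Tests and rates. For a fixed density $f_0$ and $Q\in\mathcal Q_\alpha$, a $\gamma$-level test $\Delta_{\gamma,Q}$ is a $\{0,1\}$-valued measurable function of $(Z_1,\dots,Z_n)$ with $\mathbb P_{Q^n_{f_0}}(\Delta_{\gamma,Q}(Z_1,\dots,Z_n)=1)\le\gamma$. For a class $\mathcal C$ of densities, $$\rho_n(\Delta_{\gamma,Q},\mathcal C,\beta,f_0)=\inf\Big\{\rho>0:\ \sup_{f\in\mathcal C,\ \|f-f_0\|_2>\rho}\mathbb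 P_{Q^n_f}(\Delta_{\gamma,Q}(Z_1,\dots,Z_n)=0)\le\beta\Big\},$$ $$\rho_n^*(\mathcal C,\alpha,\gamma,\beta,f_0)=\inf_{Q\in\mathcal Q_\alpha}\inf_{\Delta_{\gamma,Q}}\rho_n(\Delta_{\gamma,Q},\mathcal C,\beta,f_0),$$ where the inner infimum is over all $\gamma$-level tests based on the private views. Class $\mathcal D$: the set of densities of the form $f=d\sum_{j=0}^{d-1}p_j\mathbf 1_{[j/d,(j+1)/d)}$ with $p=(p_0,\dots,p_{d-1})$ a probability vector. *)

(* Defs.v *)
From HB Require Import structures.
From mathcomp Require Import all_boot all_order all_algebra.
From mathcomp Require Import all_classical all_reals all_analysis.
From mathcomp Require Import measurable_realfun.
Set Implicit Arguments.
Unset Strict Implicit.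
Unset Printing Implicit Defensive.
Import Order.TTheory GRing.Theory Num.Theory.
Import numFieldNormedType.Exports.
Local Open Scope classical_set_scope.
Local Open Scope ring_scope.

(* Densities on [0,1]. They are carried by functions on R; their values outside
   [0,1] are neither constrained nor ever used. *)
Record density (R : realType) := Density {
  dens :> R -> R ;
  dens_measurable : measurable_fun (`[0, 1] : set R) dens ;
  dens_ge0 : forall x : R, x \in `[0, 1] -> 0 <= dens x ;
  dens_int1 : (\int[lebesgue_measure]_(x in `[0%R, 1%R]) (dens x)%:E = 1)%E
}.

Section unif_density.
Variable R : realType.

Let unif_fun : R -> R := \1_`[0, 1].

Let unif_measurable : measurable_fun (`[0, 1] : set R) unif_fun.
Proof. exact/measurable_funTS/measurable_indic. Qed.

Let unif_ge0 x : x \in `[0, 1] -> 0 <= unif_fun x.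
Proof. by move=> _; rewrite /unif_fun indicE. Qed.

Let unif_int1 :
  (\int[lebesgue_measure]_(x in `[0%R, 1%R]) (unif_fun x)%:E = 1)%E.
Proof.
rewrite integral_indic//= setIid lebesgue_measure_itv/= lte_fin ltr01.
by rewrite oppr0 adde0.
Qed.

Definition unif_density : density R :=
  Density unif_measurable unif_ge0 unif_int1.

End unif_density.

Record mspace := MSpace {
  mspace_disp : measure_display ;
  mspace_sort :> measurableType mspace_disp
}.

(* The product T_0 * (T_1 * (... * (T_(n-1) * unit))), carrying the library's
   product sigma-algebra. *)
Fixpoint prod_mspace n : ('I_n -> mspace) -> mspace :=
  match n with
  | 0 => fun _ => MSpace unit
  | m.+1 => fun T =>
      MSpace (T ord0 * prod_mspace (fun i : 'I_m => T (lift ord0 i)))%type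
  end.

Fixpoint box n : forall T : 'I_n -> mspace,
    (forall i, set (T i)) -> set (prod_mspace T) :=
  match n with
  | 0 => fun _ _ => setT
  | m.+1 => fun T S => S ord0 `*` box (fun i : 'I_m => S (lift ord0 i))
  end.

Fixpoint prod_prob (R : realType) n : forall T : 'I_n -> mspace,
    (forall i, probability (T i) R) -> probability (prod_mspace T) R :=
  match n with
  | 0 => fun _ _ => \d_tt
  | m.+1 => fun T P =>
      (P ord0 \x prod_prob (fun i : 'I_m => P (lift ord0 i)))%E
  end.

Lemma measurable_box n (T : 'I_n -> mspace) (S : forall i, set (T i)) :
  (forall i, measurable (S i)) -> measurable (box S).
Proof.
elim: n T S => [|n IH] T S mS //=.
by apply: measurableX => //; apply: IH => i; exact: mS.
Qed.

Lemma prod_prob_box (R : realType) n (T : 'I_n -> mspace)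
    (P : forall i, probability (T i) R) (S : forall i, set (T i)) :
  (forall i, measurable (S i)) ->
  (prod_prob P (box S) = \prod_(i < n) P i (S i))%E.
Proof.
elim: n T P S => [|n IH] T P S mS /=.
  by rewrite big_ord0 diracE in_setT.
rewrite product_measure1E//; last by apply: measurable_box => i; exact: mS.
rewrite big_ord_recl; congr (_ * _)%E.
by apply: (IH _ (fun i => P (lift ord0 i))) => i; exact: mS.
Qed.

Section view_law.
Context {R : realType} {d} {Y : measurableType d}.
Variables (q : R.-pker (measurableTypeR R) ~> Y) (f : density R).
Local Open Scope ereal_scope.

Definition view_law (S : set Y) : \bar R :=
  \int[lebesgue_measure]_(x in `[0%R, 1%R]) (q x S * (f x)%:E).

Let view_law0 : view_law set0 = 0.
Proof.
by rewrite /view_law; under eq_integral do rewrite measure0 mul0e;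
  rewrite integral0.
Qed.

Let view_law_ge0 S : 0 <= view_law S.
Proof.
by apply: integral_ge0 => x x01; rewrite mule_ge0// lee_fin dens_ge0// -inE.
Qed.

Let measurable_view S : measurable S ->
  measurable_fun (`[0%R, 1%R] : set R) (fun x => q x S * (f x)%:E).
Proof.
move=> mS; apply: emeasurable_funM.
  by apply: measurable_funTS; exact: (measurable_kernel q).
by apply/measurable_EFinP; exact: dens_measurable.
Qed.

Let view_law_sigma_additive : semi_sigma_additive view_law.
Proof.
move=> F mF tF mUF.
rewrite (_ : view_law _ = \sum_(0 <= i <oo) view_law (F i)).
  by apply: is_cvg_ereal_nneg_natsum => n _; exact: view_law_ge0.
rewrite /view_law -integral_nneseries//=.
- apply: eq_integral => x x01; rewrite measure_semi_bigcup// muleC.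
  by rewrite -nneseriesZl//; under eq_eseriesr do rewrite muleC.
- by move=> n; exact: measurable_view.
- by move=> n x x01; rewrite mule_ge0// lee_fin dens_ge0.
Qed.

HB.instance Definition _ := isMeasure.Build _ _ _ view_law
  view_law0 view_law_ge0 view_law_sigma_additive.

Let view_law_setT : view_law setT = 1.
Proof.
rewrite /view_law -(dens_int1 f); apply: eq_integral => x _.
by rewrite prob_kernel mul1e.
Qed.

HB.instance Definition _ :=
  Measure_isProbability.Build _ _ R view_law view_law_setT.

End view_law.

(* The input space is R rather than [0,1]: a Markov kernel on [0,1] extends to R
   (constantly outside [0,1]), and only its values on [0,1] are ever used. The
   output spaces are arbitrary and may differ from one index to another. *)
Record channel (R : realType) (n : nat) := Channel {
  view : 'I_n -> mspace ;
  kern : forall i, R.-pker (measurableTypeR R) ~> view i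
}.

(* Division in \bar R satisfies 0 / 0 = 0 and a / 0 = +oo for a > 0. *)
Definition private (R : realType) n (alpha : R) (Q : channel R n) : Prop :=
  forall i : 'I_n,
    (ereal_sup [set r | exists S (x x' : R), [/\ measurable S, x \in `[0%R, 1%R],
        x' \in `[0%R, 1%R] & r = kern Q i x S / kern Q i x' S]]
     <= (expR alpha)%:E)%E.

Definition views_law (R : realType) n (Q : channel R n) (f : density R) :
    probability (prod_mspace (view Q)) R :=
  prod_prob (fun i => view_law (kern Q i) f).

Lemma views_law_box (R : realType) n (Q : channel R n) (f : density R)
    (S : forall i, set (view Q i)) : (forall i, measurable (S i)) ->
  (views_law Q f (box S) =
   \prod_(i < n) \int[lebesgue_measure]_(x in `[0%R, 1%R])
     (kern Q i x (S i) * (f x)%:E))%E.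
Proof. exact: prod_prob_box. Qed.

Definition level_test (R : realType) n (gamma : R) (f0 : density R)
    (Q : channel R n) : set (prod_mspace (view Q) -> bool) :=
  [set Delta | measurable_fun setT Delta /\
    (views_law Q f0 (Delta @^-1` [set true]) <= gamma%:E)%E].
Arguments level_test {R n} gamma f0 Q.

Definition L2dist (R : realType) (f g : density R) : \bar R :=
  'N[mrestr lebesgue_measure (measurable_itv `[0%R, 1%R])]_2%:E
    [(fun x => (f x - g x)%:E)]%E.

Definition test_rate (R : realType) n (Q : channel R n)
    (Delta : prod_mspace (view Q) -> bool) (C : set (density R))
    (beta : R) (f0 : density R) : \bar R :=
  ereal_inf [set rho%:E | rho in [set rho : R | 0 < rho /\
    (ereal_sup [set views_law Q f (Delta @^-1` [set false]) |
       f in C `&` [set f | rho%:E < L2dist f f0]] <= beta%:E)%E]].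

Definition minimax_rate (R : realType) (n : nat) (C : set (density R))
    (alpha gamma beta : R) (f0 : density R) : \bar R :=
  ereal_inf [set r | exists2 Q : channel R n, private alpha Q &
    r = ereal_inf [set test_rate Delta C beta f0 |
                     Delta in level_test gamma f0 Q]].

Definition piecewise_const (R : realType) (d : nat) : set (density R) :=
  [set f | exists p : 'I_d -> R,
    [/\ forall j, 0 <= p j, \sum_(j < d) p j = 1 &
      forall x : R, x \in `[0, 1] -> f x =
        d%:R * \sum_(j < d) p j * \1_`[j%:R / d%:R, j.+1%:R / d%:R[ x]].

Definition z_ (R : realType) (alpha : R) : R :=
  expR (2 * alpha) - expR (- (2 * alpha)).

(* Main.v *)
Require Import Defs.
From mathcomp Require Import all_boot all_order all_algebra.
From mathcomp Require Import all_classical all_reals all_analysis.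
From mathcomp Require Import measurable_realfun zify ring lra.
Set Implicit Arguments.
Unset Strict Implicit.
Unset Printing Implicit Defensive.
Import Order.TTheory GRing.Theory Num.Theory.
Local Open Scope ring_scope.

(** The bound is a second moment argument. Fix a channel and a test of level
    gamma, and let B be the event that it accepts. If some mixture of
    alternatives gives the views a law whose chi-square divergence from the null
    law is at most ((1 - gamma - beta) / 2)^2, then B has probability more than
    beta under the mixture, hence under one of the alternatives, and the rate of
    the test is at least the L2 distance from the mixed alternatives to the null
    density ([test_rate_ge]). Both terms of the maximum come from a choice of
    mixture.

    The divergence is controlled without densities on the product of the view
    spaces. A perturbation of one coordinate obeys a Cauchy-Schwarz inequality
    with some kernel K on the alternatives ([chi_dominated]), and this
    inequality tensorizes: the kernels multiply ([chi_dominated_prod]). Two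
    kernels are available, and each is a bilinear form in the cell
    probabilities. For every channel one may take the L2 inner product of the
    densities themselves, because a channel cannot increase information
    ([gram_controls_data]). For a private channel one may take the Gram matrix
    H of the densities of the view laws of the d cells with respect to the null
    view law; these densities lie in [e^-alpha, e^alpha], so the differences of
    two of them have norm at most z_alpha ([gram_controls_private]).

    The term n^(-1/2) d^(-1/4) uses the first kernel. The cells are put in
    groups of order sqrt d cells; in each group a uniformly chosen cell is
    raised and the others are lowered. With this group size the same
    construction serves all n: for small n the raised cells are high and rare,
    and no positivity problem arises ([data_rate_ge]).

    The term with z_alpha uses the second kernel. The alternatives move mass
    between the two cells of a pair, by amounts theta in R^(d/2), and the
    relevant matrix is the Gram matrix G of the differences over pairs, summed
    over the coordinates; its diagonal is at most lam = n z_alpha^2, but its norm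
    can be d/2 times larger, so theta must avoid the directions where G is large.
    Instead of diagonalizing G, take theta = delta A eps where eps is a uniform
    vector of signs and A = (1 + G / lam)^-1. This resolvent is a contraction,
    A G A has norm at most lam, and the diagonal of A is at least 1/2
    ([resolvent]). So the coordinates of A eps are subgaussian, and bounded by
    O(sqrt (ln d)) simultaneously, which is the origin of the logarithm; the norm
    of A eps is of order sqrt d with probability bounded below. Conditioning on
    these two events costs only a constant factor, since they are invariant under
    eps -> - eps: after symmetrization the exponential moment is that of a
    nonnegative variable cosh x - 1, whose restricted expectation is at most the
    full one ([rademacher_prior]). *)

(** * Bilinear forms and discriminants *)

Definition bilin (R : pzRingType) (A : finType) (V : A -> A -> R)
    (c c' : A -> R) : R :=
  \sum_a \sum_b c a * c' b * V a b.

(** Testing at (s, t) = (Q, - L), (- L, P) or (1, - L) avoids square roots. *)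
Lemma discriminant_le (R : realFieldType) (P L Q : R) :
  (forall s t, 0 <= s ^+ 2 * P + 2 * s * t * L + t ^+ 2 * Q) -> L ^+ 2 <= P * Q.
Proof.
move=> H.
have P0 : 0 <= P by have := H 1 0; lra.
have Q0 : 0 <= Q by have := H 0 1; lra.
have [Qp|Q0'] := ltP 0 Q.
  have : 0 <= Q * (P * Q - L ^+ 2) by have := H Q (- L); nra.
  by rewrite pmulr_rge0// subr_ge0.
have QE : Q = 0 by apply/le_anti; rewrite Q0 Q0'.
have [Pp|P0'] := ltP 0 P.
  have : 0 <= P * (P * Q - L ^+ 2) by have := H (- L) P; nra.
  by rewrite pmulr_rge0// subr_ge0.
have PE : P = 0 by apply/le_anti; rewrite P0 P0'.
by have := H 1 (- L); rewrite PE QE; nra.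
Qed.

Lemma form_ge0_of_discriminant (R : realFieldType) (P L Q s t : R) :
  0 <= P -> 0 <= Q ->
  L ^+ 2 <= P * Q -> 0 <= s ^+ 2 * P + 2 * s * t * L + t ^+ 2 * Q.
Proof.
rewrite le_eqVlt => /predU1P[<-|P0] Q0 LPQ.
  have -> : L = 0.
    by apply/eqP; rewrite -sqrf_eq0 eq_le sqr_ge0 (le_trans LPQ)// mul0r.
  by rewrite !mulr0 !add0r mulr_ge0// sqr_ge0.
rewrite -(pmulr_rge0 _ P0).
have : 0 <= (s * P + t * L) ^+ 2 + t ^+ 2 * (P * Q - L ^+ 2).
  by rewrite addr_ge0// ?sqr_ge0// mulr_ge0 ?sqr_ge0 ?subr_ge0.
by congr (_ <= _); ring.
Qed.

(** * Bounded functions and bounded densities *)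

Local Open Scope classical_set_scope.
Local Open Scope ring_scope.

Section Bounded.
Context (R : realType) (d : measure_display) (T : measurableType d).
Implicit Types (mu nu : probability T R) (f w : T -> R).

Lemma bounded_integrable mu f M : measurable_fun setT f ->
  (forall x, `|f x| <= M) -> mu.-integrable setT (EFin \o f).
Proof.
move=> mf fM; apply: measurable_bounded_integrable => //.
  by rewrite (le_lt_trans (probability_le1 mu measurableT))// ltry.
exists M; split; first exact: num_real.
by move=> y My x _; exact: le_trans (fM x) (ltW My).
Qed.

Lemma null_of_integral_le0 mu (N : set T) (h : T -> \bar R) : measurable N ->
  mu.-integrable N h -> (forall x, N x -> (0 < h x)%E) ->
  (\int[mu]_(x in N) h x <= 0)%E -> mu N = 0%E.
Proof.
move=> mN hi h0 ih; have mh := measurable_int _ hi.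
have h00 : (\int[mu]_(x in N) `|h x| = 0)%E.
  apply/eqP; rewrite eq_le integral_ge0// andbT; apply: le_trans ih.
  rewrite le_eqVlt; apply/orP; left; apply/eqP; apply: eq_integral => x.
  by rewrite inE => /h0 ?; rewrite gee0_abs// ltW.
have /ae_eq_integral_abs := h00; move=> /(_ mN mh) [A [mA A0 sub]].
apply/eqP; rewrite -measure_le0 -A0 le_measure ?inE// => x Nx; apply: sub.
by move=> /= /(_ Nx) hx; have := h0 _ Nx; rewrite hx ltxx.
Qed.

(** A Radon-Nikodym derivative, clipped so that the bounds hold everywhere and
    not only almost everywhere: the Gram matrices built from these densities can
    then be estimated pointwise. *)
Lemma clipped_density (mu nu : probability T R) (a b : R) : a <= b ->
  (forall S, measurable S -> (a%:E * nu S <= mu S)%E) ->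
  (forall S, measurable S -> (mu S <= b%:E * nu S)%E) ->
  exists g : T -> R, [/\ measurable_fun setT g, forall x, a <= g x <= b &
    forall w, measurable_fun setT w -> (forall x, 0 <= w x) ->
      \int[mu]_x w x = \int[nu]_x (w x * g x)].
Proof.
move=> ab lo hi.
have dom : mu `<< nu.
  apply/null_content_dominatesP => A mA A0; apply/eqP.
  by rewrite -measure_le0 (le_trans (hi _ mA))// A0 mule0.
pose f := Radon_Nikodym_SigmaFinite.f mu nu.
have f0 := Radon_Nikodym_SigmaFinite.f_ge0 dom.
have ff := Radon_Nikodym_SigmaFinite.f_fin_num dom.
have fi := Radon_Nikodym_SigmaFinite.f_integrable dom.
have fI := Radon_Nikodym_SigmaFinite.f_integral dom.
have mf : measurable_fun setT f := measurable_int _ fi.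
have mff : measurable_fun setT (fine \o f) by exact: measurableT_comp.
pose g x := Num.min b (Num.max a (fine (f x))).
have mg : measurable_fun setT g.
  by apply: measurable_minr => //; apply: measurable_maxr.
have ci c : nu.-integrable setT (cst c%:E).
  by apply: (@bounded_integrable nu (cst c) `|c|) => // x; exact: measurable_cst.
have iN c N : measurable N -> (\int[nu]_(x in N) c%:E = c%:E * nu N)%E.
  by move=> mN; rewrite integral_cst.
have null1 : nu [set x | (b%:E < f x)%E] = 0%E.
  have mN : measurable [set x | (b%:E < f x)%E].
    by rewrite -[X in measurable X]setTI; exact: emeasurable_fun_o_infty.
  apply: (@null_of_integral_le0 _ _ (fun x => f x - b%:E)%E) => //.
  - by apply: (integrableS measurableT) => //;
      apply: (integrableB measurableT fi (ci b)).
  - by move=> x bx; rewrite sube_gt0.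
  rewrite integralB//; last 2 first.
    - exact: (integrableS measurableT mN (@subsetT _ _) fi).
    - exact: (integrableS measurableT mN (@subsetT _ _) (ci b)).
  by rewrite iN// -fI// sube_le0 hi.
have null2 : nu [set x | (f x < a%:E)%E] = 0%E.
  have mN : measurable [set x | (f x < a%:E)%E].
    by rewrite -[X in measurable X]setTI; exact: emeasurable_fun_infty_o.
  apply: (@null_of_integral_le0 _ _ (fun x => a%:E - f x)%E) => //.
  - by apply: (integrableS measurableT) => //;
      apply: (integrableB measurableT (ci a) fi).
  - by move=> x bx; rewrite sube_gt0.
  rewrite integralB//; last 2 first.
    - exact: (integrableS measurableT mN (@subsetT _ _) (ci a)).
    - exact: (integrableS measurableT mN (@subsetT _ _) fi).
  by rewrite iN// -fI// sube_le0 lo.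
exists g; split => //.
  by move=> x; rewrite /g ge_min lexx le_min ab le_max lexx.
move=> w mw w0; congr fine.
rewrite -(Radon_Nikodym_SigmaFinite.change_of_variables dom)//; last first.
  exact/measurable_EFinP.
apply: ae_eq_integral => //.
- by apply: emeasurable_funM => //; exact/measurable_EFinP.
- by apply/measurable_EFinP; exact: measurable_funM.
exists ([set x | (b%:E < f x)%E] `|` [set x | (f x < a%:E)%E]); split.
- apply: measurableU; rewrite -[X in measurable X]setTI.
    exact: emeasurable_fun_o_infty.
  exact: emeasurable_fun_infty_o.
- apply: null_set_setU => //; rewrite -[X in measurable X]setTI.
    exact: emeasurable_fun_o_infty.
  exact: emeasurable_fun_infty_o.
move=> x /= /not_implyP [_]; apply: contraPP => /not_orP [].
move=> /negP; rewrite -leNgt => fb /negP; rewrite -leNgt => fa; apply.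
rewrite EFinM; congr (_ * _)%E; rewrite -[LHS](fineK (ff x)); congr EFin.
move: fa fb; rewrite -[f x](fineK (ff x)) !lee_fin /g => fa fb /=.
by rewrite (max_idPr fa) (min_idPr fb).
Qed.

Definition bounded_mfun f := measurable_fun setT f /\ exists M, forall x, `|f x| <= M.

Lemma bounded_mfun_integrable mu f : bounded_mfun f -> mu.-integrable setT (EFin \o f).
Proof. by case=> mf [M fM]; exact: bounded_integrable fM. Qed.

Lemma bounded_mfun_cst c : bounded_mfun (cst c).
Proof. by split; [exact: measurable_cst|exists `|c|]. Qed.

Lemma bounded_mfunD f g : bounded_mfun f -> bounded_mfun g ->
  bounded_mfun (fun x => f x + g x).
Proof.
move=> [mf [M fM]] [mg [M' gM]]; split; first exact: measurable_funD.
by exists (M + M') => x; rewrite (le_trans (ler_normD _ _))// lerD.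
Qed.

Lemma bounded_mfunM f g : bounded_mfun f -> bounded_mfun g ->
  bounded_mfun (fun x => f x * g x).
Proof.
move=> [mf [M fM]] [mg [M' gM]]; split; first exact: measurable_funM.
by exists (M * M') => x; rewrite normrM ler_pM.
Qed.

Lemma bounded_mfunZ c f : bounded_mfun f -> bounded_mfun (fun x => c * f x).
Proof. by move=> bf; apply: bounded_mfunM => //; exact: bounded_mfun_cst. Qed.

Lemma bounded_mfun_sum I (r : seq I) (F : I -> T -> R) :
  (forall i, bounded_mfun (F i)) ->
  bounded_mfun (fun x => \sum_(i <- r) F i x).
Proof.
move=> bF; elim: r => [|i r IH].
  by under [X in bounded_mfun X]eq_fun do rewrite big_nil; exact: bounded_mfun_cst.
by under [X in bounded_mfun X]eq_fun do rewrite big_cons; exact: bounded_mfunD.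
Qed.

Lemma bounded_mfun01 f : measurable_fun setT f ->
  (forall x, 0 <= f x <= 1) -> bounded_mfun f.
Proof.
move=> mf f01; split=> //; exists 1 => x.
by case/andP: (f01 x) => f0 f1; rewrite ger0_norm.
Qed.

Lemma bounded_RintegralD mu f g : bounded_mfun f -> bounded_mfun g ->
  \int[mu]_x (f x + g x) = \int[mu]_x f x + \int[mu]_x g x.
Proof. by move=> bf bg; rewrite RintegralD//; exact: bounded_mfun_integrable. Qed.

Lemma bounded_RintegralZ mu c f : bounded_mfun f ->
  \int[mu]_x (c * f x) = c * \int[mu]_x f x.
Proof. by move=> bf; rewrite RintegralZl//; exact: bounded_mfun_integrable. Qed.

Lemma bounded_Rintegral_sum mu I (r : seq I) (F : I -> T -> R) :
  (forall i, bounded_mfun (F i)) ->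
  \int[mu]_x (\sum_(i <- r) F i x) = \sum_(i <- r) \int[mu]_x F i x.
Proof.
move=> bF; elim: r => [|i r IH].
  under eq_Rintegral do rewrite big_nil.
  by rewrite Rintegral_cst// mul0r big_nil.
under eq_Rintegral do rewrite big_cons.
by rewrite big_cons bounded_RintegralD ?IH//; exact: bounded_mfun_sum.
Qed.

Lemma Rintegral_prob_cst mu c : \int[mu]_x (cst c x) = c.
Proof. rewrite Rintegral_cst//. by rewrite /= probability_setT mulr1. Qed.

End Bounded.

(** * A chi-square inequality that tensorizes *)

Section ChiDom.
Context (R : realType) (A : finType).

(** With V = 1 and w_a = N the indicator of an event, this says that the signed measure
    sum_a c_a mu_a has squared mass on any event at most the quadratic form K at
    c times the nu-mass of the event: mu_a has the role of a law with density
    f_a, nu that of the dominating law, and K a b that of the integral of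
    f_a f_b. Functions w_a that already satisfy such an inequality with kernel V
    are allowed so that the property can be iterated over coordinates. *)
Definition chi_dominated (d : measure_display) (T : measurableType d)
    (mu : A -> probability T R) (nu : probability T R) (K : A -> A -> R) : Prop :=
  forall (w : A -> T -> R) (N : T -> R) (V : A -> A -> R),
    (forall a, measurable_fun setT (w a)) -> (forall a x, 0 <= w a x <= 1) ->
    measurable_fun setT N -> (forall x, 0 <= N x <= 1) ->
    (forall c, 0 <= bilin V c c) ->
    (forall x c, (\sum_a c a * w a x) ^+ 2 <= bilin V c c * N x) ->
  forall c, 0 <= bilin (fun a b => K a b * V a b) c c /\
    (\sum_a c a * \int[mu a]_x w a x) ^+ 2 <=
    bilin (fun a b => K a b * V a b) c c * \int[nu]_x N x.

(** The index j allows the laws mu_a to be mixtures of the m_j with densities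
    f_a j. With J a singleton this is domination by a measure; with constant
    f_a j it compares mixtures through their weights alone. *)
Lemma chi_dominated_density (d : measure_display) (T : measurableType d)
    (mu : A -> probability T R) (nu : probability T R) (K : A -> A -> R)
    (J : finType) (m : J -> probability T R) (u : J -> R) (f : A -> J -> T -> R) :
  (forall j, 0 <= u j) -> (forall a j, bounded_mfun (f a j)) ->
  (forall a (w : T -> R), measurable_fun setT w -> (forall x, 0 <= w x <= 1) ->
     \int[mu a]_x w x = \sum_j u j * \int[m j]_x (w x * f a j x)) ->
  (forall w : T -> R, measurable_fun setT w -> (forall x, 0 <= w x <= 1) ->
     \int[nu]_x w x = \sum_j u j * \int[m j]_x w x) ->
  (forall a b, K a b = \sum_j u j * \int[m j]_x (f a j x * f b j x)) ->
  chi_dominated mu nu K.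
Proof.
move=> u0 bf muE nuE KE w N V mw w01 mN N01 V0 wV c.
have bw a : bounded_mfun (w a) by exact: bounded_mfun01.
have bN : bounded_mfun N by exact: bounded_mfun01.
pose H j x := \sum_a c a * f a j x * w a x.
pose W j x := bilin V (fun a => c a * f a j x) (fun a => c a * f a j x).
have bH j : bounded_mfun (H j).
  by apply: bounded_mfun_sum => a; apply: bounded_mfunM => //; exact: bounded_mfunZ.
have bW' j a b : bounded_mfun (fun x => c a * f a j x * (c b * f b j x) * V a b).
  by do ![exact: bounded_mfun_cst|apply: bounded_mfunM => //].
have bW j : bounded_mfun (W j).
  by apply: bounded_mfun_sum => a; exact: bounded_mfun_sum.
have LE : \sum_a c a * \int[mu a]_x w a x = \sum_j u j * \int[m j]_x H j x.
  under eq_bigr do rewrite muE// mulr_sumr.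
  rewrite exchange_big; apply: eq_bigr => j _ /=.
  rewrite bounded_Rintegral_sum; last first.
    by move=> a; apply: bounded_mfunM => //; exact: bounded_mfunZ.
  rewrite mulr_sumr; apply: eq_bigr => a _.
  rewrite mulrCA; congr (_ * _); rewrite -bounded_RintegralZ; last exact: bounded_mfunM.
  by apply: eq_Rintegral => x _; ring.
have PE : bilin (fun a b => K a b * V a b) c c = \sum_j u j * \int[m j]_x W j x.
  rewrite /bilin; under eq_bigr => a _.
    under eq_bigr => b _ do rewrite KE mulr_suml mulr_sumr.
    rewrite exchange_big /=; over.
  rewrite exchange_big; apply: eq_bigr => j _ /=.
  rewrite /W /bilin bounded_Rintegral_sum; last by move=> a; exact: bounded_mfun_sum.
  rewrite mulr_sumr; apply: eq_bigr => a _.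
  rewrite bounded_Rintegral_sum// mulr_sumr; apply: eq_bigr => b _.
  have -> : c a * c b * (u j * (\int[m j]_x (f a j x * f b j x)) * V a b) =
    u j * (c a * c b * V a b * \int[m j]_x (f a j x * f b j x)) by ring.
  congr (_ * _); rewrite -bounded_RintegralZ; last exact: bounded_mfunM.
  by apply: eq_Rintegral => x _; ring.
rewrite LE PE nuE//; split.
  apply: sumr_ge0 => j _; rewrite mulr_ge0//; apply: Rintegral_ge0 => x _.
  exact: V0.
(* Cauchy-Schwarz: the pointwise inequality makes this form in (s, t)
   nonnegative before integration. *)
apply: discriminant_le => s t.
have bs j : bounded_mfun (fun x => s ^+ 2 * W j x + 2 * s * t * H j x) by
  apply: bounded_mfunD; exact: bounded_mfunZ.
have -> : s ^+ 2 * (\sum_j u j * \int[m j]_x W j x) +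
    2 * s * t * (\sum_j u j * \int[m j]_x H j x) +
    t ^+ 2 * (\sum_j u j * \int[m j]_x N x) =
  \sum_j u j * \int[m j]_x (s ^+ 2 * W j x + 2 * s * t * H j x + t ^+ 2 * N x).
  rewrite 3!mulr_sumr -2!big_split /=; apply: eq_bigr => j _.
  rewrite bounded_RintegralD//; last exact: bounded_mfunZ.
  rewrite bounded_RintegralD ?bounded_RintegralZ//.
  - by ring.
  - exact: bounded_mfunZ.
  - exact: bounded_mfunZ.
apply: sumr_ge0 => j _; rewrite mulr_ge0//; apply: Rintegral_ge0 => x _.
apply: form_ge0_of_discriminant; [exact: V0|by case/andP: (N01 x)|].
by rewrite /H; exact: wV.
Qed.

Lemma bilin1 (c : A -> R) : bilin (fun _ _ => 1) c c = (\sum_a c a) ^+ 2.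
Proof.
rewrite /bilin expr2 mulr_suml; apply: eq_bigr => a _; rewrite mulr_sumr.
by apply: eq_bigr => b _; rewrite mulr1.
Qed.

(** Induction on the number of coordinates: the sections of B along the first
    coordinate satisfy the inequality for the remaining ones, which is the
    hypothesis required of the functions w_a. *)
Lemma chi_dominated_prod n (T : 'I_n -> mspace)
    (mu : A -> forall i, probability (T i) R) (nu : forall i, probability (T i) R)
    (K : 'I_n -> A -> A -> R) :
  (forall i, chi_dominated (fun a => mu a i) (nu i) (K i)) ->
  forall B, measurable B -> forall c,
    0 <= bilin (fun a b => \prod_i K i a b) c c /\
    (\sum_a c a * fine (prod_prob (mu a) B)) ^+ 2 <=
    bilin (fun a b => \prod_i K i a b) c c * fine (prod_prob nu B).
Proof.
elim: n T mu nu K => [|n IH] T mu nu K dom B mB c.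
  have -> : bilin (fun a b => \prod_i K i a b) c c = (\sum_a c a) ^+ 2.
    rewrite -bilin1; apply: eq_bigr => a _; apply: eq_bigr => b _.
    by rewrite big_ord0.
  split; first exact: sqr_ge0.
  rewrite /= -mulr_suml exprMn ler_wpM2l ?sqr_ge0//.
  rewrite /= /dirac /= indicE. by case: (_ \in _); rewrite /= ?expr1n ?expr0n.
pose T' i := T (lift ord0 i).
pose P' (m : forall i, probability (T i) R) : probability (prod_mspace T') R :=
  prod_prob (fun i => m (lift ord0 i)).
pose s m x := fine (P' m (xsection B x)).
have ms m : measurable_fun setT (s m).
  by apply: measurableT_comp => //; exact: measurable_fun_xsection.
have mx x : measurable (xsection B x) by exact: measurable_xsection.
have s01 m x : 0 <= s m x <= 1.
  rewrite /s fine_ge0//= -lee_fin fineK; first exact: probability_le1.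
  exact: fin_num_measure.
have sE m : fine (prod_prob m B) = \int[m ord0]_x s m x.
  rewrite /= /product_measure1; congr fine; apply: eq_integral => x _ /=.
  by rewrite /s fineK//; exact: fin_num_measure.
have QE : bilin (fun a b => \prod_i K i a b) c c =
    bilin (fun a b => K ord0 a b * \prod_i K (lift ord0 i) a b) c c.
  apply: eq_bigr => a _; apply: eq_bigr => b _; congr (_ * _).
  exact: big_ord_recl.
have IH' x c' := IH T' (fun a i => mu a (lift ord0 i)) (fun i => nu (lift ord0 i))
  (fun i => K (lift ord0 i)) (fun i => dom (lift ord0 i)) (xsection B x) (mx x) c'.
have V0 c' : 0 <= bilin (fun a b => \prod_i K (lift ord0 i) a b) c' c'.
  by have [] := IH T' (fun a i => mu a (lift ord0 i)) (fun i => nu (lift ord0 i))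
  (fun i => K (lift ord0 i)) (fun i => dom (lift ord0 i)) setT measurableT c'.
rewrite QE sE; under eq_bigr do rewrite sE.
apply: (dom ord0 (fun a => s (mu a)) (s nu)) => // x c'.
by have [] := IH' x c'.
Qed.

End ChiDom.

(** * Step densities and the laws of their views *)

Section Mixtures.
Context (R : realType) (dsp : measure_display) (T : measurableType dsp).

Lemma integral_mixture k (nu : 'I_k -> probability T R) (mu : probability T R)
    (p : 'I_k -> R) : (forall j, 0 <= p j) ->
  (forall S, measurable S -> mu S = (\sum_j (p j)%:E * nu j S)%E) ->
  forall w : T -> R, bounded_mfun w -> (forall x, 0 <= w x) ->
  \int[mu]_x w x = \sum_j p j * \int[nu j]_x w x.
Proof.
move=> p0 muE w bw w0; have mw : measurable_fun setT (EFin \o w).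
  by apply/measurable_EFinP; case: bw.
pose m (i : nat) : {measure set T -> \bar R} :=
  if insub i is Some j then mscale (NngNum (p0 j)) (nu j) else mzero.
have mE (j : 'I_k) : m j = mscale (NngNum (p0 j)) (nu j) by rewrite /m valK.
have iE j : (\int[nu j]_x (w x)%:E)%E = (\int[nu j]_x w x)%:E.
  by rewrite fineK//; apply: integrable_fin_num => //; exact: bounded_mfun_integrable.
have msE S : measurable S -> mu S = msum m k S.
  by move=> mS; rewrite muE// /msum; apply: eq_bigr => j _; rewrite mE.
rewrite /Rintegral (@eq_measure_integral _ _ _ _ (msum m k)); last first.
  by move=> S mS _; exact: msE.
rewrite ge0_integral_measure_sum//; last by move=> x _; rewrite lee_fin.
under eq_bigr => j _.
  rewrite mE ge0_integral_mscale//; last by move=> x _; rewrite lee_fin.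
  rewrite iE -EFinM; over.
by rewrite sumEFin.
Qed.

End Mixtures.

Section Steps.
Context (R : realType).
Implicit Types (x : R).

Definition cell (k j : nat) : set R := `[j%:R / k%:R, j.+1%:R / k%:R[.

Definition step k (p : 'I_k -> R) x : R := k%:R * \sum_(j < k) p j * \1_(cell k j) x.

Definition is_prob k (p : 'I_k -> R) : Prop :=
  (forall j, 0 <= p j) /\ \sum_j p j = 1.

Lemma is_prob_gt0 k (p : 'I_k -> R) : is_prob p -> (0 < k)%N.
Proof.
case: k p => // p [_]; rewrite big_ord0 => /eqP.
by rewrite eq_sym oner_eq0.
Qed.

Lemma measurable_cell k j : measurable (cell k j).
Proof. exact: measurable_itv. Qed.

Lemma indic_cell k j x : (0 < k)%N -> 0 <= x ->
  \1_(cell k j) x = (Num.truncn (x * k%:R) == j)%:R :> R.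
Proof.
move=> k0 x0; have kp : 0 < k%:R :> R by rewrite ltr0n.
rewrite indicE; congr (_%:R); rewrite truncn_eq ?mulr_ge0//.
rewrite -ler_pdivrMr// -ltr_pdivlMr//; congr nat_of_bool.
apply/idP/idP; rewrite inE /cell /= in_itv//=.
Qed.

Lemma cell_sub01 k (j : 'I_k) x : cell k j x -> 0 <= x < 1.
Proof.
have k0 : (0 < k)%N by case: k j => [[]|].
have kp : 0 < k%:R :> R by rewrite ltr0n.
rewrite /cell /= in_itv/= => /andP[lo hi]; apply/andP; split.
  by apply: le_trans lo; rewrite divr_ge0.
apply: lt_le_trans hi _; rewrite ler_pdivrMr// mul1r ler_nat; exact: ltn_ord.
Qed.

Lemma lebesgue_cell k j : (0 < k)%N -> lebesgue_measure (cell k j) = (k%:R^-1 : R)%:E.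
Proof.
move=> k0; have kp : 0 < k%:R :> R by rewrite ltr0n.
rewrite /cell lebesgue_measure_itv/= lte_fin ltr_pM2r ?invr_gt0// ltr_nat ltnSn.
by rewrite -EFinD -mulrBl -natrB// subSnn mul1r.
Qed.

Lemma measurable_step k (p : 'I_k -> R) : measurable_fun setT (step p).
Proof.
apply: measurable_funM => //; apply: measurable_sum => j.
apply: measurable_funM => //; exact: measurable_indic (measurable_cell k j).
Qed.

Lemma step_ge0 k (p : 'I_k -> R) x : (forall j, 0 <= p j) -> 0 <= step p x.
Proof.
move=> p0; rewrite mulr_ge0// sumr_ge0// => j _.
by rewrite mulr_ge0// indicE.
Qed.

Lemma integral_step k (p : 'I_k -> R) : is_prob p ->
  (\int[lebesgue_measure]_(x in `[0%R, 1%R]) (step p x)%:E = 1)%E.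
Proof.
move=> pp; have k0 := is_prob_gt0 pp; case: pp => p0 p1.
under eq_integral => x _.
  rewrite /step mulr_sumr -sumEFin.
  under eq_bigr => j _ do rewrite mulrA EFinM.
  over.
rewrite ge0_integral_sum//; last 2 first.
- move=> j; apply: measurable_funTS; apply: measurable_funeM.
  by apply/measurable_EFinP; exact: measurable_indic (measurable_cell k j).
- by move=> j x _; rewrite -EFinM lee_fin !mulr_ge0// indicE.
transitivity (\sum_j (p j)%:E)%E; last by rewrite sumEFin p1.
apply: eq_bigr => j _.
rewrite ge0_integralZl//; last 2 first.
- apply/measurable_EFinP; apply: measurable_funTS.
  exact: measurable_indic (measurable_cell k j).
- by rewrite lee_fin mulr_ge0.
rewrite integral_indic//; last exact: measurable_cell.
rewrite setIidl; last by move=> x /cell_sub01 /andP[x0 x1]; rewrite /= in_itv/= x0 ltW.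
rewrite [X in (_ * X)%E](_ : _ = lebesgue_measure (cell k j))//.
by rewrite lebesgue_cell// -EFinM mulrAC mulfV ?mul1r// pnatr_eq0 -lt0n.
Qed.

(** Vanishes at the point 1, as the cells are half-open, so it differs there from
    the uniform density even for equal cell probabilities. *)
Definition step_density k (p : 'I_k -> R) (pp : is_prob p) : density R :=
  Density (measurable_funTS (measurable_step p)) (fun x _ => step_ge0 x pp.1)
    (integral_step pp).

Lemma piecewise_const_step k (p : 'I_k -> R) (pp : is_prob p) :
  piecewise_const k (step_density pp).
Proof. by case: (pp) => p0 p1; exists p; split. Qed.

Definition vertex k (j : 'I_k) : 'I_k -> R := fun i => (i == j)%:R.

Lemma vertex_prob k (j : 'I_k) : is_prob (vertex j).
Proof.
split=> // ; rewrite (bigD1 j)//= /vertex eqxx big1 ?addr0// => i /negbTE ->.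
by [].
Qed.

Definition flat k : 'I_k -> R := fun=> k%:R^-1.

Lemma flat_prob k : (0 < k)%N -> is_prob (flat (k := k)).
Proof.
move=> k0; split=> [j|]; first by rewrite invr_ge0.
by rewrite sumr_const card_ord -[LHS]mulr_natr mulVf// pnatr_eq0 -lt0n.
Qed.

End Steps.

Section ViewLaws.
Context (R : realType) (dsp : measure_display) (Y : measurableType dsp).
Variable q : R.-pker (measurableTypeR R) ~> Y.

Lemma measurable_view (f : density R) S : measurable S ->
  measurable_fun (`[0%R, 1%R] : set R) (fun x => q x S * (f x)%:E)%E.
Proof.
move=> mS; apply: emeasurable_funM.
  by apply: measurable_funTS; exact: (measurable_kernel q).
by apply/measurable_EFinP; exact: dens_measurable.
Qed.

Lemma view_law_step k (p : 'I_k -> R) (pp : is_prob p) S : measurable S ->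
  view_law q (step_density pp) S =
  (\sum_j (p j)%:E * view_law q (step_density (vertex_prob R j)) S)%E.
Proof.
move=> mS; have p0 := pp.1; rewrite /view_law /=.
have vertex0 j x : 0 <= step (vertex R j) x.
  by apply: step_ge0; case: (vertex_prob R j).
transitivity (\int[lebesgue_measure]_(x in `[0%R, 1%R])
   (\sum_j (p j)%:E * (q x S * (step (vertex R j) x)%:E)))%E.
  apply: eq_integral => x _.
  rewrite (_ : step p x = \sum_j p j * step (vertex R j) x); last first.
    rewrite /step mulr_sumr; apply: eq_bigr => j _.
    rewrite (bigD1 j)//= /vertex eqxx big1 ?addr0 ?mul1r 1?mulrCA//.
    by move=> i /negbTE ->; rewrite mul0r.
  rewrite -sumEFin ge0_sume_distrr//.
    by apply: eq_bigr => j _; rewrite EFinM muleCA.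
  by move=> j _; rewrite lee_fin mulr_ge0// vertex0.
rewrite ge0_integral_sum//; last 2 first.
- move=> j; apply: measurable_funeM.
  exact: (measurable_view (step_density (vertex_prob R j))).
- move=> j x _; rewrite !mule_ge0// lee_fin.
    by case: pp => + _; exact.
  exact: vertex0.
apply: eq_bigr => j _; rewrite ge0_integralZl//.
- exact: (measurable_view (step_density (vertex_prob R j))).
- by move=> x _; rewrite mule_ge0// lee_fin vertex0.
- by rewrite lee_fin.
Qed.

Lemma view_law_unif k (k0 : (0 < k)%N) S : measurable S ->
  view_law q (unif_density R) S = view_law q (step_density (flat_prob R k0)) S.
Proof.
move=> mS; rewrite /view_law.
have openE (f : density R) :
    (\int[lebesgue_measure]_(x in `[0%R, 1%R]) (q x S * (f x)%:E) =
     \int[lebesgue_measure]_(x in `[0%R, 1%R[) (q x S * (f x)%:E))%E.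
  apply/esym; apply: integral_itv_bndo_bndc.
  apply: measurable_funS (measurable_view f mS) => //.
  by apply: subset_itvl; rewrite bnd_simp.
rewrite !openE.
apply: eq_integral => x; rewrite inE /= in_itv/= => /andP[x0 x1].
congr (_ * _%:E)%E; rewrite indicE mem_set/=; last by rewrite /= in_itv/= x0 ltW.
have kp : 0 < k%:R :> R by rewrite ltr0n.
have jk : (Num.truncn (x * k%:R) < k)%N.
  by rewrite truncn_lt_nat ?mulr_ge0// -ltr_pdivlMr// mulfV ?gt_eqF.
rewrite /step (bigD1 (Ordinal jk))//= indic_cell// eqxx mulr1 big1.
  by rewrite addr0 /flat mulfV// gt_eqF.
move=> i /negbTE ne; rewrite indic_cell// eq_sym.
by move: ne; rewrite -val_eqE/= => ->; rewrite mulr0.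
Qed.

(** A pointwise ratio bound on the kernel passes to any two view laws, since both
    are averages of the kernel over [0, 1]. *)
Lemma view_law_le (c : R) (f g : density R) S : measurable S ->
  (forall x x' : R, x \in `[0%R, 1%R] -> x' \in `[0%R, 1%R] ->
     (q x S <= c%:E * q x' S)%E) -> 0 <= c ->
  (view_law q f S <= c%:E * view_law q g S)%E.
Proof.
move=> mS qc c0.
have lef x' : x' \in `[0%R, 1%R] -> (view_law q f S <= c%:E * q x' S)%E.
  move=> x'01; rewrite /view_law -[leRHS]mule1 -(dens_int1 f).
  rewrite -ge0_integralZl//; last 3 first.
  - by apply/measurable_EFinP; exact: dens_measurable.
  - by move=> x x01; rewrite lee_fin dens_ge0// -inE.
  - by rewrite mule_ge0.
  apply: ge0_le_integral => //.
  - by move=> x x01; rewrite mule_ge0// lee_fin dens_ge0// -inE.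
  - exact: measurable_view.
  - by apply/measurable_funeM/measurable_EFinP; exact: (dens_measurable f).
  - move=> x x01; apply: lee_wpmul2r; last exact: (qc x x' x01 x'01).
    by rewrite lee_fin dens_ge0// -inE.
have v0 : (0 <= view_law q f S)%E by [].
move: lef v0; move: (view_law q f S) => v lef v0.
rewrite -[leLHS]mule1 -(dens_int1 g) -ge0_integralZl//; last 2 first.
- by apply/measurable_EFinP; exact: dens_measurable.
- by move=> x x01; rewrite lee_fin dens_ge0// -inE.
rewrite /view_law -ge0_integralZl//; last 2 first.
- exact: measurable_view.
- by move=> x x01; rewrite mule_ge0// lee_fin dens_ge0// -inE.
apply: ge0_le_integral => //.
- by move=> x x01; rewrite mule_ge0// lee_fin dens_ge0// -inE.
- by apply: measurable_funeM; apply/measurable_EFinP; exact: dens_measurable.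
- by apply: measurable_funeM; exact: measurable_view.
- move=> x x01; rewrite muleA; apply: lee_wpmul2r; last exact: (lef x x01).
  by rewrite lee_fin dens_ge0// -inE.
Qed.

End ViewLaws.

(** * Kernels of a channel on the cell probabilities *)

(** The properties of the Gram matrix of the densities of k laws with respect to
    their average that are used below; z bounds the distance between two of the
    densities. *)
Definition gram (R : realType) (k : nat) (z : R) (H : 'I_k -> 'I_k -> R) : Prop :=
  [/\ forall i j, 0 <= H i j, forall i j, H i j = H j i,
      forall j, \sum_i H i j = k%:R, forall c, 0 <= bilin H c c &
      forall i j, H i i - 2 * H i j + H j j <= z ^+ 2].

Section Coordinate.
Context (R : realType) (dsp : measure_display) (Y : measurableType dsp).
Variable q : R.-pker (measurableTypeR R) ~> Y.

Definition vertex_law k (j : 'I_k) : probability Y R :=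
  view_law q (step_density (vertex_prob R j)).

Lemma integral_view_step k (p : 'I_k -> R) (pp : is_prob p) (w : Y -> R) :
  bounded_mfun w -> (forall y, 0 <= w y) ->
  \int[view_law q (step_density pp)]_y w y = \sum_j p j * \int[vertex_law j]_y w y.
Proof.
move=> bw w0; apply: integral_mixture => //; first by case: pp.
by move=> S mS; exact: view_law_step.
Qed.

Lemma integral_view_unif k (k0 : (0 < k)%N) (w : Y -> R) :
  bounded_mfun w -> (forall y, 0 <= w y) ->
  \int[view_law q (unif_density R)]_y w y =
  \sum_(j < k) k%:R^-1 * \int[vertex_law j]_y w y.
Proof.
move=> bw w0; apply: integral_mixture => //.
move=> S mS.
exact: etrans (view_law_unif q k0 mS) (view_law_step q (flat_prob R k0) mS).
Qed.

(** Data processing: the kernel is the inner product of the two step densities,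
    whatever the channel. *)
Lemma chi_dominated_data k (A : finType) (p : A -> 'I_k -> R)
    (pp : forall a, is_prob (p a)) : (0 < k)%N ->
  chi_dominated (fun a => view_law q (step_density (pp a)))
    (view_law q (unif_density R)) (fun a b => k%:R * \sum_j p a j * p b j).
Proof.
move=> k0; have kp : (k%:R : R) != 0 by rewrite pnatr_eq0 -lt0n.
apply: (@chi_dominated_density _ _ _ _ _ _ _ 'I_k (@vertex_law k)
  (fun=> k%:R^-1) (fun a j => cst (k%:R * p a j))).
- by move=> j; rewrite invr_ge0.
- by move=> a j; exact: bounded_mfun_cst.
- move=> a w mw w01; have bw := bounded_mfun01 mw w01.
  rewrite integral_view_step//; last by move=> x; case/andP: (w01 x).
  apply: eq_bigr => j _; under [in RHS]eq_Rintegral do rewrite mulrC.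
  by rewrite bounded_RintegralZ// mulrA mulrA mulVf// mul1r.
- move=> w mw w01; have bw := bounded_mfun01 mw w01.
  by rewrite (integral_view_unif k0)// => x; case/andP: (w01 x).
- move=> a b; rewrite mulr_sumr; apply: eq_bigr => j _.
  by rewrite (Rintegral_prob_cst _ (k%:R * p a j * (k%:R * p b j))); field.
Qed.

(** The matrix H is the Gram matrix of the densities of the vertex laws with
    respect to the null view law. As these lie in [e^-alpha, e^alpha], two of
    them differ by at most e^alpha - e^-alpha, which is below z_alpha. *)
Lemma chi_dominated_private k (alpha : R) : (0 < k)%N -> 0 <= alpha ->
  (forall S (x x' : R), measurable S -> x \in `[0%R, 1%R] -> x' \in `[0%R, 1%R] ->
    (q x S <= (expR alpha)%:E * q x' S)%E) ->
  exists2 H : 'I_k -> 'I_k -> R, gram (z_ alpha) H &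
  forall (A : finType) (p : A -> 'I_k -> R) (pp : forall a, is_prob (p a)),
  chi_dominated (fun a => view_law q (step_density (pp a)))
    (view_law q (unif_density R))
    (fun a b => \sum_i \sum_j p a i * p b j * H i j).
Proof.
move=> k0 al0 priv; set nu := view_law q (unif_density R).
have kp : (k%:R : R) != 0 by rewrite pnatr_eq0 -lt0n.
have le1 : expR (- alpha) <= expR alpha by rewrite ler_expR; lra.
have dens (j : 'I_k) : exists g : Y -> R, [/\ measurable_fun setT g,
    forall y, expR (- alpha) <= g y <= expR alpha &
    forall w : Y -> R, measurable_fun setT w -> (forall y, 0 <= w y) ->
      \int[vertex_law j]_y w y = \int[nu]_y (w y * g y)].
  apply: clipped_density => //.
  - move=> S mS; rewrite expRN lee_pdivrMl ?expR_gt0//.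
    apply: view_law_le => //.
    by move=> x x' ? ?; exact: priv.
  - move=> S mS.
    apply: view_law_le => //.
    by move=> x x' ? ?; exact: priv.
have [g gP] := choice dens.
have mg j : measurable_fun setT (g j) by have [] := gP j.
have gb j y : expR (- alpha) <= g j y <= expR alpha.
  by have [_ gb _] := gP j; exact: gb.
have gI j (w : Y -> R) : measurable_fun setT w -> (forall y, 0 <= w y) ->
    \int[vertex_law j]_y w y = \int[nu]_y (w y * g j y).
  by have [_ _ gI] := gP j; exact: gI.
have g0 j y : 0 <= g j y by case/andP: (gb j y) => + _; apply: le_trans; exact: expR_ge0.
have bg j : bounded_mfun (g j).
  by split=> //; exists (expR alpha) => y; rewrite ger0_norm//; case/andP: (gb j y).
have bgg i j : bounded_mfun (fun y => g i y * g j y) by apply: bounded_mfunM.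
pose H i j := \int[nu]_y (g i y * g j y).
have Hq c : bilin H c c = \int[nu]_y (\sum_j c j * g j y) ^+ 2.
  under eq_Rintegral => y _.
    rewrite expr2 mulr_suml; under eq_bigr do rewrite mulr_sumr.
    over.
  have bt i j : bounded_mfun (fun y => c i * g i y * (c j * g j y)).
    by apply: bounded_mfunM; exact: bounded_mfunZ.
  rewrite /= bounded_Rintegral_sum; last by move=> i; exact: bounded_mfun_sum.
  apply: eq_bigr => i _; rewrite bounded_Rintegral_sum//; apply: eq_bigr => j _.
  by rewrite -bounded_RintegralZ//; apply: eq_Rintegral => y _; ring.
exists H; first split.
- by move=> i j; apply: Rintegral_ge0 => y _; exact: mulr_ge0.
- by move=> i j; apply: eq_Rintegral => y _; rewrite mulrC.
- move=> j; have h1 : \int[nu]_y g j y = 1.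
    rewrite -(Rintegral_prob_cst (vertex_law j) 1) gI//.
    by apply: eq_Rintegral => y _; rewrite mul1r.
  have := integral_view_unif k0 (bg j) (g0 j); rewrite -/nu h1 -mulr_sumr.
  move=> e; have -> : \sum_i H i j = \sum_(i < k) \int[vertex_law i]_y g j y.
    apply: eq_bigr => i _; rewrite gI//.
    by apply: eq_Rintegral => y _; rewrite mulrC.
  by apply: (mulfI (invr_neq0 kp)); rewrite -e mulVf.
- move=> c; rewrite Hq; apply: Rintegral_ge0 => y _; exact: sqr_ge0.
- move=> i j.
  have -> : H i i - 2 * H i j + H j j = \int[nu]_y (g i y - g j y) ^+ 2.
    rewrite /H -mulNr -bounded_RintegralZ// -bounded_RintegralD//; last exact: bounded_mfunZ.
    rewrite -bounded_RintegralD//; last by apply: bounded_mfunD => //; exact: bounded_mfunZ.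
    by apply: eq_Rintegral => y _; ring.
  have zE : z_ alpha = (expR alpha - expR (- alpha)) * (expR alpha + expR (- alpha)).
    rewrite /z_ (_ : 2 * alpha = alpha + alpha); last by ring.
    by rewrite opprD !expRD; ring.
  have ee : expR alpha * expR (- alpha) = 1 by rewrite -expRD subrr expR0.
  have h1 : 1 <= expR alpha + expR (- alpha).
    have : 1 <= expR alpha by rewrite -expR0 ler_expR.
    have := expR_ge0 (- alpha); lra.
  have zb : expR alpha - expR (- alpha) <= z_ alpha.
    by rewrite zE ler_peMr// subr_ge0.
  rewrite -[leRHS](Rintegral_prob_cst nu); apply: le_Rintegral => //.
  + apply: bounded_mfun_integrable; under [X in bounded_mfun X]eq_fun do rewrite expr2.
    have bd : bounded_mfun (fun y => g i y - g j y).
      under [X in bounded_mfun X]eq_fun do rewrite -mulN1r.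
      by apply: bounded_mfunD => //; exact: bounded_mfunZ.
    exact: bounded_mfunM.
  + exact/bounded_mfun_integrable/bounded_mfun_cst.
  move=> y _ /=; have := gb i y; have := gb j y => /andP[a1 a2] /andP[b1 b2].
  have : `|g i y - g j y| <= z_ alpha.
    by rewrite ler_norml; apply/andP; split; lra.
  by rewrite -ler_sqr ?nnegrE ?normr_ge0// ?real_normK ?num_real//; lra.
move=> A p pp.
apply: (@chi_dominated_density _ _ _ _ _ _ _ unit (fun=> nu)
  (fun=> 1) (fun a _ y => \sum_j p a j * g j y)).
- by move=> _.
- by move=> a _; apply: bounded_mfun_sum => j; exact: bounded_mfunZ.
- move=> a w mw w01; have bw := bounded_mfun01 mw w01.
  have w0 x : 0 <= w x by case/andP: (w01 x).
  rewrite integral_view_step// big_const card_unit/= addr0 mul1r.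
  under [RHS]eq_Rintegral do rewrite /= mulr_sumr.
  rewrite bounded_Rintegral_sum; last first.
    by move=> j; apply: bounded_mfunM => //; exact: bounded_mfunZ.
  apply: eq_bigr => j _; rewrite gI// -bounded_RintegralZ; last exact: bounded_mfunM.
  by apply: eq_Rintegral => y _; ring.
- by move=> w mw w01; rewrite big_const card_unit/= addr0 mul1r.
- move=> a b; rewrite big_const card_unit/= addr0 mul1r.
  have bt i j : bounded_mfun (fun y => p a i * g i y * (p b j * g j y)).
    by apply: bounded_mfunM; exact: bounded_mfunZ.
  transitivity (\int[nu]_y \sum_i \sum_j p a i * g i y * (p b j * g j y)).
    rewrite bounded_Rintegral_sum; last by move=> i; exact: bounded_mfun_sum.
    apply: eq_bigr => i _; rewrite bounded_Rintegral_sum//; apply: eq_bigr => j _.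
    by rewrite -bounded_RintegralZ//; apply: eq_Rintegral => y _; ring.
  apply: eq_Rintegral => y _; rewrite mulr_suml.
  by apply: eq_bigr => i _; rewrite mulr_sumr.
Qed.

End Coordinate.

(** If the denominator vanishes, the quotient is finite only when the numerator
    vanishes too, so the multiplicative form holds in all cases. *)
Lemma private_kernel_le (R : realType) n (alpha : R) (Q : channel R n) i S (x x' : R) :
  private alpha Q -> measurable S -> x \in `[0%R, 1%R] -> x' \in `[0%R, 1%R] ->
  (kern Q i x S <= (expR alpha)%:E * kern Q i x' S)%E.
Proof.
move=> priv mS x01 x'01.
have : (kern Q i x S / kern Q i x' S <= (expR alpha)%:E)%E.
  apply: le_trans (priv i); apply: ereal_sup_ubound.
  by exists S, x, x'; split.
have fin y : kern Q i y S \is a fin_num.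
  rewrite ge0_fin_numE//; apply: (@le_lt_trans _ _ (kern Q i y setT)).
    by rewrite le_measure ?inE.
  by rewrite prob_kernel ltry.
have : (0 <= kern Q i x' S)%E by [].
rewrite le_eqVlt => /predU1P[<-|pos].
  rewrite inve0 mule0; have : (0 <= kern Q i x S)%E by [].
  rewrite le_eqVlt => /predU1P[<-//|pos].
  by rewrite gt0_muley// leye_eq.
rewrite -[kern Q i x' S]fineK// in pos *; rewrite lte_fin in pos.
by rewrite inver gt_eqF// lee_pdivrMr.
Qed.

Lemma eq_prod_prob (R : realType) n (T : 'I_n -> mspace)
    (P P' : forall i, probability (T i) R) :
  (forall i S, measurable S -> P i S = P' i S) ->
  forall B, measurable B -> prod_prob P B = prod_prob P' B.
Proof.
elim: n T P P' => [//|n IH] T P P' PP' B mB.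
rewrite /= /product_measure1 (@eq_measure_integral _ _ _ _ (P' ord0)); last first.
  by move=> S mS _; exact: PP'.
apply: eq_integral => x _ /=.
apply: (IH _ (fun i => P (lift ord0 i)) (fun i => P' (lift ord0 i))).
  by move=> i S; exact: PP'.
exact: measurable_xsection.
Qed.

(** * From chi-square bounds to separation rates *)

Definition gram_controls (R : realType) n k (Q : channel R n)
    (H : 'I_n -> 'I_k -> 'I_k -> R) : Prop :=
  [/\ forall i j, \sum_l H i l j = k%:R, forall i j l, H i j l = H i l j &
    forall i (A : finType) (p : A -> 'I_k -> R) (pp : forall a, is_prob (p a)),
    chi_dominated (fun a => view_law (kern Q i) (step_density (pp a)))
      (view_law (kern Q i) (unif_density R)) (fun a b => bilin (H i) (p a) (p b))].

Section Mixture.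
Context (R : realType) (n k : nat) (Q : channel R n) (k0 : (0 < k)%N).
Variable H : 'I_n -> 'I_k -> 'I_k -> R.
Hypothesis HQ : gram_controls Q H.

Let Hrow i j : \sum_l H i l j = k%:R. Proof. by case: HQ. Qed.
Let Hsym i j l : H i j l = H i l j. Proof. by case: HQ. Qed.

Lemma bilin_flat i p : is_prob p -> bilin (H i) (@flat R k) p = 1.
Proof.
case=> _ p1; have kp : (k%:R : R) != 0 by rewrite pnatr_eq0 -lt0n.
rewrite /bilin exchange_big /= -p1; apply: eq_bigr => j _.
transitivity (k%:R^-1 * p j * \sum_l H i l j); first by rewrite mulr_sumr.
by rewrite Hrow mulrAC mulVf// mul1r.
Qed.

Lemma bilin_sym i p p' : bilin (H i) p p' = bilin (H i) p' p.
Proof.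
rewrite /bilin exchange_big; apply: eq_bigr => j _; apply: eq_bigr => l _.
by rewrite Hsym mulrAC mulrC mulrA mulrAC.
Qed.

(** The left-hand side is a signed combination of the product laws, with
    coefficient -1 on the null law; the cross terms with the null law all equal 1
    because the rows of H sum to k. *)
Lemma mixture_power (P : finType) (w : P -> R) (p : P -> 'I_k -> R)
    (pp : forall s, is_prob (p s)) B : \sum_s w s = 1 -> measurable B ->
  (\sum_s w s * fine (views_law Q (step_density (pp s)) B) -
    fine (views_law Q (unif_density R) B)) ^+ 2 <=
  \sum_s \sum_t w s * w t * \prod_i bilin (H i) (p s) (p t) - 1.
Proof.
move=> w1 mB; have [_ _ Hdom] := HQ.
(* The left summand stands for the null law. *)
pose p' (o : unit + P) := if o is inr s then p s else @flat R k.
have @pp' o : is_prob (p' o).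
  by case: o => [u|s]; [exact: flat_prob|exact: pp].
pose c (o : unit + P) := if o is inr s then w s else -1.
have [q0] := @chi_dominated_prod R (unit + P)%type n (view Q)
  (fun o i => view_law (kern Q i) (step_density (pp' o)))
  (fun i => view_law (kern Q i) (unif_density R))
  (fun i a b => bilin (H i) (p' a) (p' b)) (fun i => Hdom i _ _ pp') B mB c.
have flatE : prod_prob (fun i => view_law (kern Q i) (step_density (pp' (inl tt)))) B =
    views_law Q (unif_density R) B.
  apply: eq_prod_prob => // i S mS; rewrite /= (view_law_unif _ k0)//.
have K1 (s : P) : \prod_i bilin (H i) (@flat R k) (p s) = 1.
  by apply: big1 => i _; rewrite bilin_flat.
have K1' (s : P) : \prod_i bilin (H i) (p s) (@flat R k) = 1.
  by apply: big1 => i _; rewrite bilin_sym bilin_flat.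
have K0 : \prod_i bilin (H i) (@flat R k) (@flat R k) = 1.
  by apply: big1 => i _; rewrite bilin_flat//; exact: flat_prob.
have sumT (F : unit + P -> R) : \sum_o F o = F (inl tt) + \sum_s F (inr s).
  by rewrite big_sumType/= (bigD1 tt)//= big1 ?addr0// => -[].
rewrite sumT flatE mulN1r addrC => h; apply: le_trans h _.
set f0 := fine _.
have f01 : f0 <= 1.
  rewrite -lee_fin fineK; first exact: probability_le1.
  exact: fin_num_measure.
have chiE : bilin (fun a b => \prod_i bilin (H i) (p' a) (p' b)) c c =
    \sum_s \sum_t w s * w t * \prod_i bilin (H i) (p s) (p t) - 1.
  rewrite {1}/bilin sumT sumT/= K0.
  under eq_bigr do rewrite K1 mulr1 mulN1r.
  under [X in _ + X]eq_bigr do rewrite sumT /= K1' mulr1.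
  by rewrite sumrN w1 big_split/= -mulr_suml w1; ring.
by rewrite chiE in q0 *; apply: ler_piMr.
Qed.

(** The probability of acceptance is at least 1 - gamma under the null, and the
    mixture changes it by at most half of 1 - gamma - beta. *)
Lemma test_rate_ge (P : finType) (w : P -> R) (p : P -> 'I_k -> R)
    (pp : forall s, is_prob (p s)) (gamma beta r : R) Delta :
  (forall s, 0 <= w s) -> \sum_s w s = 1 -> gamma + beta < 1 ->
  (forall s, w s != 0 -> (r%:E <= L2dist (step_density (pp s)) (unif_density R))%E) ->
  \sum_s \sum_t w s * w t * \prod_i bilin (H i) (p s) (p t) - 1 <=
    ((1 - gamma - beta) / 2) ^+ 2 ->
  level_test gamma (unif_density R) Q Delta ->
  (r%:E <= test_rate Delta (piecewise_const k) beta (unif_density R))%E.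
Proof.
move=> w0 w1 gb far chi [mD lev].
apply/ereal_infP => _ [rho [rho0 sup] <-]; rewrite leNgt; apply/negP => rho_r.
set B := Delta @^-1` [set false].
have mB : measurable B by rewrite -[B]setTI; exact: mD.
have PB : 1 - gamma <= fine (views_law Q (unif_density R) B).
  have -> : B = ~` (Delta @^-1` [set true]).
    by apply/seteqP; split=> x; rewrite /B /=; case: (Delta x).
  have mB' : measurable (Delta @^-1` [set true]).
    by rewrite -[X in measurable X]setTI; exact: mD.
  rewrite probability_setC// fineB//; last exact: fin_num_measure.
  by rewrite lerD2l lerN2 -lee_fin fineK//; exact: fin_num_measure.
have small s : w s * fine (views_law Q (step_density (pp s)) B) <= w s * beta.
  have [->|ws] := eqVneq (w s) 0; first by rewrite !mul0r.
  apply: ler_wpM2l => //; rewrite -lee_fin fineK; last exact: fin_num_measure.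
  apply: le_trans sup; apply: ereal_sup_ubound; exists (step_density (pp s)) => //.
  split; first exact: piecewise_const_step.
  exact: lt_le_trans rho_r (far _ ws).
have avg : \sum_s w s * fine (views_law Q (step_density (pp s)) B) <= beta.
  by rewrite -[leRHS]mul1r -w1 mulr_suml; exact: ler_sum.
have := le_trans (mixture_power pp w1 mB) chi.
move: avg PB; set a := \sum_s _; set b := fine _ => avg PB.
apply/negP; rewrite -ltNge.
have D0 : 0 < 1 - gamma - beta by lra.
have Dab : 1 - gamma - beta <= b - a by lra.
rewrite (_ : (a - b) ^+ 2 = (b - a) ^+ 2); last by ring.
by rewrite ltr_sqr ?nnegrE; lra.
Qed.

End Mixture.

Lemma gram_controls_data (R : realType) n k (Q : channel R n) : (0 < k)%N ->
  gram_controls Q (fun _ (i j : 'I_k) => k%:R * (i == j)%:R : R).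
Proof.
move=> k0; split.
- move=> _ j; rewrite -mulr_sumr (bigD1 j)//= eqxx big1 ?addr0 ?mulr1//.
  by move=> i /negbTE ->.
- by move=> _ i j; rewrite eq_sym.
move=> i A p pp.
have := chi_dominated_data (kern Q i) pp k0; congr chi_dominated.
apply/funext => a; apply/funext => b; rewrite /bilin mulr_sumr.
apply: eq_bigr => j _; rewrite (bigD1 j)//= eqxx mulr1 big1 ?addr0; first by rewrite mulrC.
by move=> l /negbTE; rewrite eq_sym => ->; rewrite !mulr0.
Qed.

Lemma gram_controls_private (R : realType) n k (Q : channel R n) (alpha : R) :
  (0 < k)%N -> 0 <= alpha -> private alpha Q ->
  exists2 H : 'I_n -> 'I_k -> 'I_k -> R,
    forall i, gram (z_ alpha) (H i) & gram_controls Q H.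
Proof.
move=> k0 al0 priv.
have coord i := chi_dominated_private (q := kern Q i) k0 al0
  (fun S x x' => private_kernel_le (i := i) (S := S) (x := x) (x' := x') priv).
have [i|H HP] := choice (P := fun i H => gram (z_ alpha) H /\
    forall (A : finType) (p : A -> 'I_k -> R) (pp : forall a, is_prob (p a)),
    chi_dominated (fun a => view_law (kern Q i) (step_density (pp a)))
      (view_law (kern Q i) (unif_density R)) (fun a b => bilin H (p a) (p b))).
  by have [H] := coord i; exists H.
exists H; first by move=> i; case: (HP i).
split=> [i j|i j l|i A p pp].
- by case: (HP i) => -[].
- by case: (HP i) => -[].
- by case: (HP i) => _; exact.
Qed.

(** Only a lower bound on the distance is needed, so the integrand is compared
    with a step function that vanishes at 1 and outside [0, 1]. *)
Lemma L2dist_step_ge (R : realType) k (p : 'I_k -> R) (pp : is_prob p) (r : R) :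
  0 <= r -> r ^+ 2 <= k%:R^-1 * \sum_j (k%:R * p j - 1) ^+ 2 ->
  (r%:E <= L2dist (step_density pp) (unif_density R))%E.
Proof.
move=> r0 rle; rewrite /L2dist unlock /=.
have k0 := is_prob_gt0 pp.
set mu := (X in (\int[X]_x _)%E).
pose s x := \sum_(j < k) (k%:R * p j - 1) ^+ 2 * \1_(@cell R k j) x.
have s0 x : 0 <= s x by apply: sumr_ge0 => j _; rewrite mulr_ge0 ?sqr_ge0// indicE.
have ms : measurable_fun setT (EFin \o s).
  apply/measurable_EFinP; apply: measurable_sum => j; apply: measurable_funM => //.
  exact: measurable_indic (@measurable_cell R k j).
have intS : (\int[mu]_x (s x)%:E = (k%:R^-1 * \sum_j (k%:R * p j - 1) ^+ 2)%:E)%E.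
  under eq_integral => x _.
    rewrite /s -sumEFin. under eq_bigr do rewrite EFinM. over.
  rewrite ge0_integral_sum//; last 2 first.
  - move=> j; apply: measurable_funeM.
    by apply/measurable_EFinP; exact: measurable_indic (@measurable_cell R k j).
  - by move=> j x _; rewrite -EFinM lee_fin mulr_ge0 ?sqr_ge0// indicE.
  rewrite mulr_sumr -sumEFin; apply: eq_bigr => j _.
  rewrite ge0_integralZl//; last 2 first.
  - by apply/measurable_EFinP; exact: measurable_indic (@measurable_cell R k j).
  - by rewrite lee_fin sqr_ge0.
  rewrite integral_indic//; last exact: measurable_cell.
  rewrite [RHS]EFinM [RHS]muleC; congr (_ * _)%E.
  transitivity (lebesgue_measure (@cell R k j)); last exact: lebesgue_cell.
  rewrite -[in RHS](_ : (cell k j `&` setT) `&` `[0%R, 1%R] = cell k j)//.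
  by rewrite setIT setIidl// => x /cell_sub01 /andP[x0 x1]; rewrite /= in_itv/= x0 ltW.
have sle x : ((s x)%:E <= `|(step p x - \1_`[0%R, 1%R] x)%:E| `^ 2)%E.
  rewrite abse_EFin poweR_EFin lee_fin (powR_mulrn 2)// real_normK ?num_real//.
  have [x0|x0] := ltP x 0.
    rewrite /s big1 ?sqr_ge0// => j _; rewrite indicE memNset ?mulr0//.
    by move=> /cell_sub01/andP[]; rewrite leNgt x0.
  have [jk|kj] := ltnP (Num.truncn (x * k%:R)) k; last first.
    rewrite /s big1 ?sqr_ge0// => j _; rewrite indic_cell//.
    by rewrite gtn_eqF ?mulr0// (leq_trans (ltn_ord j)).
  have kp : 0 < k%:R :> R by rewrite ltr0n.
  have x1 : x < 1.
    by move: jk; rewrite truncn_lt_nat ?mulr_ge0// gtr_pMl.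
  have one (F : 'I_k -> R) : \sum_(j < k) F j * \1_(@cell R k j) x = F (Ordinal jk).
    rewrite (bigD1 (Ordinal jk))//= indic_cell// eqxx mulr1 big1 ?addr0//.
    move=> i /negbTE ne; rewrite indic_cell// eq_sym.
    by move: ne; rewrite -val_eqE/= => ->; rewrite mulr0.
  rewrite /s one /step one indicE mem_set//=; rewrite /= in_itv/= x0 ltW//.
have rE : r%:E = ((r ^+ 2)%:E `^ 2^-1)%E.
  by rewrite poweR12_sqrt ?lee_fin ?sqr_ge0//= sqrtr_sqr ger0_norm.
rewrite rE; apply: gt0_ler_poweR; first by rewrite invr_ge0.
- by rewrite in_itv/= leey andbT lee_fin sqr_ge0.
- by rewrite in_itv/= leey andbT; apply: integral_ge0.
apply: (@le_trans _ _ (\int[mu]_x (s x)%:E)%E); first by rewrite intS lee_fin.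
apply: ge0_le_integral => //.
  by move=> x _; rewrite lee_fin.
apply/measurable_EFinP.
apply: (measurableT_comp (measurable_powR _)); apply: measurableT_comp => //.
apply: measurable_funB; first exact: measurable_step.
exact: measurable_indic.
Qed.

Local Close Scope classical_set_scope.

(** * Perturbations of the uniform distribution *)

Section Tilt.
Context (R : realType) (k : nat).
Hypothesis k0 : (0 < k)%N.
Implicit Types (eta : 'I_k -> R) (H : 'I_k -> 'I_k -> R).

Let kp : 0 < k%:R :> R. Proof. by rewrite ltr0n. Qed.

Definition tilt eta (j : 'I_k) : R := (1 + eta j) / k%:R.

Lemma tilt_prob eta : \sum_j eta j = 0 -> (forall j, -1 <= eta j) ->
  is_prob (tilt eta).
Proof.
move=> s0 e1; split=> [j|].
  by rewrite divr_ge0 ?ler0n//; have := e1 j; lra.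
rewrite -mulr_suml big_split/= s0 addr0 sumr_const card_ord.
by rewrite -[_ *+ _]mul1r mulrnAr mul1r mulfV// gt_eqF.
Qed.

Lemma bilin_tilt H eta eta' : (forall j, \sum_l H l j = k%:R) ->
  (forall i j, H i j = H j i) -> \sum_j eta j = 0 -> \sum_j eta' j = 0 ->
  bilin H (tilt eta) (tilt eta') = 1 + k%:R ^- 2 * bilin H eta eta'.
Proof.
move=> Hr Hs s0 s0'.
have Hr' j : \sum_l H j l = k%:R by rewrite -(Hr j); apply: eq_bigr => l _.
have kk : k%:R ^- 2 * (k%:R * k%:R) = 1 :> R by field; rewrite gt_eqF.
transitivity (k%:R ^- 2 * (k%:R * k%:R + bilin H eta eta')); last first.
  by rewrite mulrDr kk.
transitivity (k%:R ^- 2 * \sum_i \sum_j (H i j + eta i * H i j + eta' j * H i j +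
   eta i * eta' j * H i j)).
  rewrite mulr_sumr; apply: eq_bigr => i _; rewrite mulr_sumr.
  by apply: eq_bigr => j _; rewrite /tilt; field; rewrite gt_eqF.
congr (_ * _).
under eq_bigr do rewrite !big_split/=.
rewrite !big_split/=.
have -> : \sum_i \sum_j H i j = k%:R * k%:R.
  under eq_bigr do rewrite Hr'.
  by rewrite sumr_const card_ord -[LHS]mulr_natr.
have -> : \sum_i \sum_j eta i * H i j = 0.
  under eq_bigr do rewrite -mulr_sumr Hr'.
  by rewrite -mulr_suml s0 mul0r.
have -> : \sum_i \sum_j eta' j * H i j = 0.
  rewrite exchange_big /=; under eq_bigr do rewrite -mulr_sumr Hr.
  by rewrite -mulr_suml s0' mul0r.
by rewrite !addr0.
Qed.

Lemma L2dist_tilt eta (pp : is_prob (tilt eta)) (r : R) : 0 <= r ->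
  r ^+ 2 <= k%:R^-1 * \sum_j eta j ^+ 2 ->
  (r%:E <= L2dist (step_density pp) (unif_density R))%E.
Proof.
move=> r0 rle; apply: L2dist_step_ge => //.
rewrite (eq_bigr (fun j => eta j ^+ 2))// => j _; congr (_ ^+ 2).
by rewrite /tilt mulrCA mulfV ?gt_eqF//; ring.
Qed.

End Tilt.

Lemma bilin_ge0 (R : realType) k (H : 'I_k -> 'I_k -> R) (p p' : 'I_k -> R) :
  (forall i j, 0 <= H i j) -> is_prob p -> is_prob p' -> 0 <= bilin H p p'.
Proof.
move=> H0 [p0 _] [p0' _]; apply: sumr_ge0 => i _; apply: sumr_ge0 => j _.
by rewrite !mulr_ge0.
Qed.

Lemma prod_le_expR_sum (R : realType) n (a x : 'I_n -> R) :
  (forall i, 0 <= a i) -> (forall i, a i = 1 + x i) ->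
  \prod_i a i <= expR (\sum_i x i).
Proof.
move=> a0 ax; rewrite expR_sum; apply: ler_prod => i _.
by rewrite a0 ax expR_ge1Dx.
Qed.

(** Square and invert exp (- x / 2) >= 1 - x / 2. *)
Lemma expR_le_quad (R : realType) (x : R) : x <= 4^-1 -> expR x <= 1 + x + x ^+ 2.
Proof.
move=> x4; have h : 1 - x / 2 <= expR (- (x / 2)) by exact: expR_ge1Dx.
have p : 0 < 1 - x / 2 by lra.
have -> : expR x = (expR (- (x / 2)) ^+ 2)^-1.
  by rewrite -expRM_natl -expRN; congr expR; field.
have q : (1 - x / 2) ^+ 2 <= expR (- (x / 2)) ^+ 2 by rewrite ler_sqr ?nnegrE; lra.
rewrite -[leRHS]invrK lef_pV2 ?posrE ?exprn_gt0 ?expR_gt0//; last first.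
  by rewrite invr_gt0; nra.
apply: le_trans q; rewrite -[leLHS]mul1r ler_pdivrMr; last by nra.
have : 0 <= x ^+ 2 * (1 - 3 * x + x ^+ 2) by rewrite mulr_ge0 ?sqr_ge0//; nra.
nra.
Qed.

(** * Raising one random cell in each group *)

Section Groups.
Context (R : realType) (k m g : nat).
Hypothesis g0 : (0 < g)%N.
Hypothesis gmk : (m * g <= k)%N.
Implicit Types (s t : {ffun 'I_m -> 'I_g}) (delta : R).

Lemma member_subproof (l : 'I_m) (c : 'I_g) : (l * g + c < k)%N.
Proof.
apply: leq_trans gmk; apply: (@leq_trans (l * g + g)); first by rewrite ltn_add2l.
by rewrite -mulSnr leq_mul2r ltn_ord orbT.
Qed.

Definition member l c : 'I_k := Ordinal (member_subproof l c).

Lemma group_sum (F : 'I_k -> R) (l : 'I_m) :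
  \sum_(j < k | (j %/ g)%N == l) F j = \sum_c F (member l c).
Proof.
rewrite (reindex_onto (member l) (fun j => Ordinal (ltn_pmod j g0))) /=.
  apply: eq_bigl => c; rewrite divnMDl// divn_small// addn0 eqxx /=.
  by apply/eqP/val_inj; rewrite /= modnMDl modn_small.
by move=> j /eqP jl; apply/val_inj; rewrite /= -jl -divn_eq.
Qed.

Definition bump_val delta (c c' : 'I_g) : R := delta * (g%:R *+ (c == c') - 1).

Definition group_spike delta s (j : 'I_k) : R :=
  \sum_(l < m | (j %/ g)%N == l) bump_val delta (s l) (Ordinal (ltn_pmod j g0)).

Lemma group_spike_member delta s l c :
  group_spike delta s (member l c) = bump_val delta (s l) c.
Proof.
rewrite /group_spike /= divnMDl// divn_small// addn0 (big_pred1 l) => [|l']; last first.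
  by rewrite /= eq_sym val_eqE.
by congr bump_val; apply/val_inj; rewrite /= modnMDl modn_small.
Qed.

Lemma group_spike_sum delta s (F : 'I_k -> R) :
  \sum_j group_spike delta s j * F j =
  \sum_l \sum_c bump_val delta (s l) c * F (member l c).
Proof.
under eq_bigr do rewrite /group_spike mulr_suml.
rewrite (exchange_big_dep xpredT)//=; apply: eq_bigr => l _.
rewrite (eq_bigl (fun j : 'I_k => (j %/ g)%N == l))// group_sum.
apply: eq_bigr => c _; congr (bump_val _ _ _ * _).
by apply/val_inj; rewrite /= modnMDl modn_small.
Qed.

Lemma sum_ind (c0 : 'I_g) (a : R) : \sum_(c < g) a *+ (c0 == c) = a.
Proof.
by rewrite (bigD1 c0)//= eqxx mulr1n big1 ?addr0// => c /negbTE; rewrite eq_sym => ->.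
Qed.

Lemma sum_bump_val delta (c0 : 'I_g) : \sum_c bump_val delta c0 c = 0.
Proof. by rewrite -mulr_sumr sumrB sum_ind sumr_const card_ord subrr mulr0. Qed.

(** Two bumps in a group of g cells are nearly orthogonal unless the same cell is
    raised, which happens with probability 1 / g. *)
Lemma sum_bump_val2 delta (c0 c1 : 'I_g) :
  \sum_c bump_val delta c0 c * bump_val delta c1 c =
  delta ^+ 2 * g%:R * (g%:R *+ (c0 == c1) - 1).
Proof.
transitivity (delta ^+ 2 * \sum_c ((g%:R *+ (c0 == c1)) * g%:R *+ (c0 == c) -
    g%:R *+ (c0 == c) - g%:R *+ (c1 == c) + 1)).
  rewrite mulr_sumr; apply: eq_bigr => c _; rewrite /bump_val.
  have [<-|ne] := eqVneq c0 c; first by rewrite (eq_sym c1) !mulr1n; ring.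
  by rewrite !mulr0n; ring.
rewrite big_split/= sumrB sumrB !sum_ind sumr_const card_ord; ring.
Qed.

Lemma group_spike_sum0 delta s : \sum_j group_spike delta s j = 0.
Proof.
have := group_spike_sum delta s (fun=> 1); under eq_bigr do rewrite mulr1.
move=> ->; rewrite big1// => l _; under eq_bigr do rewrite mulr1.
exact: sum_bump_val.
Qed.

Lemma group_spike_dot delta s t :
  \sum_j group_spike delta s j * group_spike delta t j =
  delta ^+ 2 * g%:R * \sum_l (g%:R *+ (s l == t l) - 1).
Proof.
rewrite group_spike_sum mulr_sumr; apply: eq_bigr => l _.
by rewrite -sum_bump_val2; apply: eq_bigr => c _; rewrite group_spike_member.
Qed.

Lemma group_spike_ge delta s j : 0 <= delta <= 1 -> -1 <= group_spike delta s j.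
Proof.
move=> /andP[d0 d1].
have bge c c' : -1 <= bump_val delta c c'.
  rewrite /bump_val; case: (c == c'); rewrite ?mulr1n ?mulr0n; last by lra.
  by have : 0 <= g%:R :> R by []; nra.
have [jm|mj] := ltnP (j %/ g) m.
  by rewrite /group_spike (big_pred1 (Ordinal jm)) // => l; rewrite /= eq_sym.
rewrite /group_spike big_pred0 ?lerN10// => l.
by apply/negbTE; rewrite neq_ltn (leq_trans (ltn_ord l)) ?orbT.
Qed.

(** The groups are independent, and in each of them the exponent is centered with
    variance at most tau^2 g; the bound on tau g keeps it in the range where
    exp x <= 1 + x + x^2. *)
Lemma group_spike_mgf (tau : R) s : 0 <= tau -> tau * g%:R <= 4^-1 ->
  \sum_(t : {ffun _ -> _}) expR (tau * \sum_l (g%:R *+ (s l == t l) - 1)) <=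
  #|{ffun 'I_m -> 'I_g}|%:R * expR (k%:R * tau ^+ 2).
Proof.
move=> t0 tg.
have -> : \sum_(t : {ffun _ -> _}) expR (tau * \sum_l (g%:R *+ (s l == t l) - 1)) =
    \prod_l \sum_(c < g) expR (tau * (g%:R *+ (s l == c) - 1)).
  rewrite bigA_distr_bigA; apply: eq_bigr => t _.
  by rewrite mulr_sumr expR_sum.
have one l : \sum_(c < g) expR (tau * (g%:R *+ (s l == c) - 1)) <=
    g%:R * expR (tau ^+ 2 * g%:R).
  have gp : 0 < g%:R :> R by rewrite ltr0n.
  apply: (@le_trans _ _ (\sum_c (1 + bump_val tau (s l) c +
      bump_val tau (s l) c * bump_val tau (s l) c))).
    apply: ler_sum => c _; rewrite -expr2; apply: expR_le_quad.
    by case: (s l == c); rewrite ?mulr1n ?mulr0n; lra.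
  rewrite !big_split/= sum_bump_val sum_bump_val2 eqxx mulr1n addr0 sumr_const card_ord.
  have := expR_ge1Dx (tau ^+ 2 * g%:R); have := sqr_ge0 tau; nra.
apply: (@le_trans _ _ (\prod_(l < m) (g%:R * expR (tau ^+ 2 * g%:R)))).
  apply: ler_prod => l _; rewrite one andbT; apply: sumr_ge0 => c _; exact: expR_ge0.
rewrite big_split/= !prodr_const !card_ord card_ffun !card_ord natrX.
rewrite ler_wpM2l ?exprn_ge0// -expRM_natl ler_expR.
have : (m * g)%:R <= k%:R :> R by rewrite ler_nat.
by rewrite natrM; have := sqr_ge0 tau; nra.
Qed.

End Groups.

Section DataRate.
Context (R : realType) (n k m g : nat) (Q : channel R n) (gamma beta delta r : R).

(** For delta^2 of order 1 / n and g of order sqrt k, the two smallness conditions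
    hold with constants and r is of order k^(1/4) n^(-1/2). *)
Lemma data_rate_ge Delta : (0 < k)%N -> (0 < g)%N -> (m * g <= k)%N ->
  gamma + beta < 1 -> 0 <= delta <= 1 ->
  n%:R * (k%:R^-1 * delta ^+ 2 * g%:R) * g%:R <= 4^-1 ->
  expR (k%:R * (n%:R * (k%:R^-1 * delta ^+ 2 * g%:R)) ^+ 2) - 1 <=
    ((1 - gamma - beta) / 2) ^+ 2 ->
  0 <= r -> r ^+ 2 <= k%:R^-1 * (delta ^+ 2 * g%:R * (m%:R * (g%:R - 1))) ->
  level_test gamma (unif_density R) Q Delta ->
  (r%:E <= test_rate Delta (piecewise_const k) beta (unif_density R))%E.
Proof.
move=> k0 g0 gmk gb d01 tg chi r0 rle lev.
have kp : 0 < k%:R :> R by rewrite ltr0n.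
have HQ := gram_controls_data Q k0.
set tau := n%:R * _ in tg chi.
have tau0 : 0 <= tau.
  apply: mulr_ge0 => //; apply: mulr_ge0 => //; apply: mulr_ge0; last exact: sqr_ge0.
  by rewrite invr_ge0.
pose eta (s : {ffun 'I_m -> 'I_g}) := group_spike g0 delta s : 'I_k -> R.
have sp s : is_prob (tilt (eta s)).
  apply: tilt_prob => //; first exact: group_spike_sum0.
  by move=> j; exact: group_spike_ge.
pose N : R := #|{ffun 'I_m -> 'I_g}|%:R.
have Np : 0 < N.
  rewrite ltr0n; apply/card_gt0P; exists [ffun=> Ordinal g0]; done.
apply: (@test_rate_ge _ _ _ _ k0 _ HQ {ffun 'I_m -> 'I_g} (fun=> N^-1) _ sp gamma beta
  _ Delta _ _ gb _ _ lev).
- by move=> s; rewrite invr_ge0 ltW.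
- by rewrite sumr_const -[LHS]mulr_natr mulVf// gt_eqF.
- move=> s _; apply: L2dist_tilt => //; apply: le_trans rle _.
  rewrite (eq_bigr (fun j => eta s j * eta s j)); last by move=> j _; rewrite expr2.
  rewrite group_spike_dot//; under [X in _ <= _ * (_ * X)]eq_bigr do rewrite eqxx mulr1n.
  by rewrite sumr_const card_ord mulr_natl.
apply: le_trans chi; rewrite lerB//.
have bE s t : bilin (fun i j : 'I_k => k%:R * (i == j)%:R) (tilt (eta s)) (tilt (eta t)) =
   1 + k%:R^-1 * delta ^+ 2 * g%:R * \sum_l (g%:R *+ (s l == t l) - 1).
  have Hr (j : 'I_k) : \sum_l k%:R * (l == j)%:R = k%:R :> R.
    rewrite -mulr_sumr (bigD1 j)//= eqxx big1 ?addr0 ?mulr1// => l /negbTE ->.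
    by [].
  rewrite bilin_tilt//; [|by move=> i j; rewrite eq_sym|exact: group_spike_sum0..].
  congr (_ + _); rewrite -2!mulrA [X in _ = _ * X]mulrA -(group_spike_dot g0 gmk).
  have -> : bilin (fun i j : 'I_k => k%:R * (i == j)%:R) (eta s) (eta t) =
      k%:R * \sum_j eta s j * eta t j.
    rewrite /bilin mulr_sumr; apply: eq_bigr => i _.
    rewrite (bigD1 i)//= eqxx big1 ?addr0 => [|j /negbTE]; first by rewrite mulr1n; ring.
    by rewrite eq_sym => ->; rewrite mulr0n !mulr0.
  by field; rewrite gt_eqF.
apply: (@le_trans _ _ (\sum_(s : {ffun 'I_m -> 'I_g})
    \sum_(t : {ffun 'I_m -> 'I_g}) N^-1 * N^-1 *
    expR (tau * \sum_l (g%:R *+ (s l == t l) - 1)))).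
  apply: ler_sum => s _; apply: ler_sum => t _; apply: ler_wpM2l.
    by rewrite mulr_ge0// invr_ge0 ltW.
  have -> : tau * \sum_l (g%:R *+ (s l == t l) - 1) =
      \sum_(i < n) k%:R^-1 * delta ^+ 2 * g%:R * \sum_l (g%:R *+ (s l == t l) - 1).
    by rewrite sumr_const card_ord -[RHS]mulr_natl mulrA.
  apply: prod_le_expR_sum => i; last by rewrite bE.
  by apply: bilin_ge0 => // a b; rewrite mulr_ge0.
apply: (@le_trans _ _ (\sum_(s : {ffun 'I_m -> 'I_g}) N^-1 * expR (k%:R * tau ^+ 2))).
  apply: ler_sum => s _; rewrite -mulr_sumr -mulrA.
  apply: ler_wpM2l; first by rewrite invr_ge0 ltW.
  by rewrite ler_pdivrMl//; exact: group_spike_mgf.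
rewrite sumr_const -[leLHS]mulr_natl mulrA mulfV ?mul1r// gt_eqF//.
Qed.

End DataRate.

(** * The resolvent of a positive semidefinite matrix *)

Section Resolvent.
Context (R : realFieldType) (m : nat).
Implicit Types (u v : 'rV[R]_m) (G : 'M[R]_m).

Definition dot u v : R := \sum_k u 0 k * v 0 k.

Lemma dotE u v : dot u v = (u *m v^T) 0 0.
Proof. by rewrite mxE; apply: eq_bigr => k _; rewrite mxE. Qed.

Lemma dotC u v : dot u v = dot v u.
Proof. by apply: eq_bigr => k _; rewrite mulrC. Qed.

Lemma dotDl u v w : dot (u + v) w = dot u w + dot v w.
Proof. by rewrite /dot -big_split; apply: eq_bigr => k _; rewrite mxE mulrDl. Qed.

Lemma dotZl a u v : dot (a *: u) v = a * dot u v.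
Proof. by rewrite /dot mulr_sumr; apply: eq_bigr => k _; rewrite mxE mulrA. Qed.

Lemma dotDr u v w : dot w (u + v) = dot w u + dot w v.
Proof. by rewrite !(dotC w) dotDl. Qed.

Lemma dotZr a u v : dot v (a *: u) = a * dot v u.
Proof. by rewrite !(dotC v) dotZl. Qed.

Lemma dot_ge0 u : 0 <= dot u u.
Proof. by apply: sumr_ge0 => k _; rewrite -expr2 sqr_ge0. Qed.

Lemma dot_eq0 u : dot u u = 0 -> u = 0.
Proof.
move=> /eqP; rewrite psumr_eq0; last by move=> k _; rewrite -expr2 sqr_ge0.
move=> /allP u0; apply/rowP => k; rewrite mxE.
by have := u0 k (mem_index_enum k); rewrite -expr2 sqrf_eq0 => /eqP.
Qed.

Lemma dot_delta u j : dot (delta_mx 0 j) u = u 0 j.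
Proof.
rewrite /dot (bigD1 j)//= mxE !eqxx mul1r big1 ?addr0// => k /negbTE kj.
by rewrite mxE kj andbF mul0r.
Qed.

Lemma dot_mulmx u v G : dot (u *m G) v = dot u (v *m G^T).
Proof. by rewrite !dotE trmx_mul trmxK mulmxA. Qed.

Lemma sqr_coord_le u j : u 0 j ^+ 2 <= dot u u.
Proof.
by rewrite /dot (bigD1 j)//= expr2 lerDl sumr_ge0// => k _; rewrite -expr2 sqr_ge0.
Qed.

(** The matrix A is (1 + G / lam)^-1. With y = u A one has
    u = y + y G / lam, and expanding the square of the norm shows that both y and
    y G / lam = u - y are at most as long as u, so u A G A = lam (u - y) A is at
    most lam times as long as u. For the diagonal, let u be the j-th basis vector
    and a = A j j: then a = |y|^2 + <y G, y> / lam, and Cauchy-Schwarz for G gives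
    a >= a^2 + (1 - a)^2, that is 1/2 <= a <= 1. *)
Lemma resolvent G (lam : R) : G^T = G -> (forall u, 0 <= dot (u *m G) u) ->
  0 < lam -> (forall j, G j j <= lam) ->
  exists A : 'M[R]_m, [/\ A^T = A, forall u, dot (u *m A) (u *m A) <= dot u u,
    forall u, dot (u *m (A *m G *m A)) (u *m (A *m G *m A)) <= lam ^+ 2 * dot u u &
    forall j, 2^-1 <= A j j].
Proof.
move=> Gs G0 lam0 Gl; have lam1 := lt0r_neq0 lam0.
pose W := 1%:M + lam^-1 *: G.
have WE (y : 'rV_m) : y *m W = y + lam^-1 *: (y *m G).
  by rewrite mulmxDr mulmx1 -scalemxAr.
have nW y : dot (y *m W) (y *m W) = dot y y + 2 * lam^-1 * dot (y *m G) y +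
    dot (lam^-1 *: (y *m G)) (lam^-1 *: (y *m G)).
  rewrite WE !dotDl !dotDr !dotZl !dotZr (dotC y (y *m G)); ring.
have li0 : 0 < lam^-1 by rewrite invr_gt0.
have cr y : 0 <= 2 * lam^-1 * dot (y *m G) y by rewrite !mulr_ge0// ltW.
have le1 y : dot y y <= dot (y *m W) (y *m W).
  by have := cr y; have := dot_ge0 (lam^-1 *: (y *m G)); rewrite nW; lra.
have le2 y : dot (lam^-1 *: (y *m G)) (lam^-1 *: (y *m G)) <= dot (y *m W) (y *m W).
  by have := cr y; have := dot_ge0 y; rewrite nW; lra.
have uW : W \in unitmx.
  rewrite -row_free_unit; apply: inj_row_free => v vW; apply: dot_eq0.
  apply/eqP; rewrite eq_le dot_ge0 andbT (le_trans (le1 v))// vW.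
  by rewrite -(scale0r 0) dotZl mul0r.
pose A := invmx W; exists A.
have AW (x : 'rV_m) : x *m A *m W = x by rewrite mulmxKV.
have A1 u : dot (u *m A) (u *m A) <= dot u u.
  by have := le1 (u *m A); rewrite AW.
have AG u : lam^-1 *: (u *m A *m G) = u - u *m A.
  by have := WE (u *m A); rewrite AW => {2}->; rewrite addrC addKr.
split => //.
- by rewrite /A trmx_inv linearD/= trmx1 linearZ/= Gs.
- move=> u; have -> : u *m (A *m G *m A) = lam *: ((u - u *m A) *m A).
    by rewrite -AG scalemxAl scalerA mulfV// scale1r !mulmxA.
  rewrite dotZl dotZr mulrA -expr2 ler_wpM2l ?sqr_ge0//.
  apply: le_trans (A1 _) _; rewrite -AG; apply: le_trans (le2 _) _.
  by rewrite AW.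
move=> j; pose y : 'rV[R]_m := delta_mx 0 j *m A; pose a := A j j.
have ya : y 0 j = a by rewrite /y -rowE mxE.
have := WE y; rewrite {1}/y AW => xE.
have e1 : a = dot y y + lam^-1 * dot (y *m G) y.
  by rewrite -ya -dot_delta {1}xE dotDl dotZl.
have e2 : 1 = a + lam^-1 * (y *m G) 0 j.
  have := congr1 (fun z => dot (delta_mx 0 j) z) xE.
  by rewrite /= dot_delta mxE !eqxx /= dotDr dotZr !dot_delta ya.
have cs : (y *m G) 0 j ^+ 2 <= G j j * dot (y *m G) y.
  rewrite mulrC; apply: discriminant_le => s t.
  have := G0 (s *: y + t *: delta_mx 0 j).
  have d1 : dot ((delta_mx 0 j : 'rV_m) *m G) (delta_mx 0 j) = G j j.
    by rewrite dotC dot_delta -rowE mxE.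
  have d2 : dot (y *m G) (delta_mx 0 j) = (y *m G) 0 j by rewrite dotC dot_delta.
  have d3 : dot ((delta_mx 0 j : 'rV_m) *m G) y = (y *m G) 0 j.
    by rewrite dot_mulmx Gs dot_delta.
  rewrite mulmxDl -!scalemxAl !dotDl !dotDr !dotZl !dotZr d1 d2 d3.
  by congr (_ <= _); ring.
have := sqr_coord_le y j; rewrite ya => a2.
have q0 : 0 <= dot (y *m G) y by [].
have bE : (y *m G) 0 j = lam * (1 - a).
  by rewrite e2 (addrC a) addrK mulrA mulfV// mul1r.
have ql : lam * (1 - a) ^+ 2 <= dot (y *m G) y.
  rewrite -(ler_pM2l lam0); apply: (le_trans _ (ler_wpM2r q0 (Gl j))).
  by apply: le_trans cs; rewrite bE le_eqVlt; apply/orP; left; apply/eqP; ring.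
have : (1 - a) ^+ 2 <= lam^-1 * dot (y *m G) y by rewrite ler_pdivlMl.
rewrite -/a; nra.
Qed.

End Resolvent.

(** * Random signs *)

(** The constant 4 is not optimal: it lets the range |x| > 1 / 4 follow from
    |x| <= 4 x^2. *)
Lemma cosh_le (R : realType) (x : R) : expR x + expR (- x) <= 2 * expR (4 * x ^+ 2).
Proof.
wlog x0 : x / 0 <= x => [H|].
  have [/H//|x0] := leP 0 x.
  by have := H (- x); rewrite opprK sqrrN addrC; apply; lra.
have [x4|x4] := leP x 4^-1.
  have h1 := expR_le_quad x4.
  have h2 : expR (- x) <= 1 - x + x ^+ 2.
    by have := @expR_le_quad R (- x); rewrite sqrrN; apply; lra.
  have := expR_ge1Dx (4 * x ^+ 2); nra.
have : expR x <= expR (4 * x ^+ 2) by rewrite ler_expR; nra.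
have : expR (- x) <= expR x by rewrite ler_expR; lra.
lra.
Qed.

Section Rademacher.
Context (R : realType) (m : nat).
Implicit Types (e : {ffun 'I_m -> bool}) (v : 'rV[R]_m) (A G : 'M[R]_m).

Definition signs e : 'rV[R]_m := \row_k (-1) ^+ e k.

Definition flip e : {ffun 'I_m -> bool} := [ffun k => ~~ e k].

Definition flip_at j e : {ffun 'I_m -> bool} := [ffun k => (k == j) (+) e k].

Local Notation N := (#|{ffun 'I_m -> bool}|%:R : R).

Lemma flipK : involutive flip.
Proof. by move=> e; apply/ffunP => k; rewrite !ffunE negbK. Qed.

Lemma flip_atK j : involutive (flip_at j).
Proof. by move=> e; apply/ffunP => k; rewrite !ffunE addbA addbb. Qed.

Lemma signs_flip e : signs (flip e) = - signs e.
Proof. by apply/rowP => k; rewrite !mxE ffunE signrN. Qed.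

Lemma signs_flip_at j e :
  signs e - signs (flip_at j e) = (2 * (-1) ^+ e j) *: delta_mx 0 j.
Proof.
apply/rowP => k; rewrite !mxE ffunE eqxx /=.
have [->|_] := eqVneq k j; last by rewrite addFb subrr mulr0.
by rewrite addTb signrN mulr1; ring.
Qed.

Lemma dot_signs e : dot (signs e) (signs e) = m%:R.
Proof.
rewrite /dot (eq_bigr (fun=> 1)) ?sumr_const ?card_ord// => k _.
by rewrite mxE -expr2 sqrr_sign.
Qed.

Lemma card_signs_gt0 : 0 < N.
Proof. by rewrite ltr0n; apply/card_gt0P; exists [ffun=> false]. Qed.

Lemma rademacher_mgf (s : R) v :
  \sum_e expR (s * dot (signs e) v) <= N * expR (4 * s ^+ 2 * dot v v).
Proof.
have -> : \sum_e expR (s * dot (signs e) v) =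
    \prod_k (expR (s * v 0 k) + expR (- (s * v 0 k))).
  transitivity (\prod_k \sum_(b : bool) expR (s * ((-1) ^+ b * v 0 k))).
    rewrite bigA_distr_bigA; apply: eq_bigr => e _.
    rewrite /dot mulr_sumr expR_sum; apply: eq_bigr => k _.
    by rewrite mxE.
  apply: eq_bigr => k _; rewrite big_bool/= addrC; congr (_ + _); congr expR.
    by rewrite expr0 mul1r.
  by rewrite expr1 mulN1r mulrN.
have -> : N * expR (4 * s ^+ 2 * dot v v) = \prod_k (2 * expR (4 * (s * v 0 k) ^+ 2)).
  rewrite big_split/= prodr_const card_ord card_ffun card_bool card_ord natrX.
  congr (_ * _); rewrite -expR_sum /dot mulr_sumr; congr expR.
  by apply: eq_bigr => k _; ring.
apply: ler_prod => k _; rewrite cosh_le andbT addr_ge0// expR_ge0.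
Qed.

(** Flipping the sign k changes the inner product by 2 v_k, so one of the two
    values is large. *)
Lemma rademacher_second_moment v k : N * v 0 k ^+ 2 <= \sum_e dot (signs e) v ^+ 2.
Proof.
have : \sum_(e : {ffun 'I_m -> bool}) (2 * v 0 k ^+ 2) <=
    \sum_e (dot (signs e) v ^+ 2 + dot (signs (flip_at k e)) v ^+ 2).
  apply: ler_sum => e _.
  have := congr1 (fun u => dot u v) (signs_flip_at k e).
  rewrite /= dotZl dot_delta -[- _]scaleN1r dotDl dotZl.
  set y := dot _ _; set y' := dot _ _ => h.
  have : (y - y') ^+ 2 = 4 * v 0 k ^+ 2.
    by rewrite -mulN1r h !exprMn sqrr_sign mulr1 -natrX.
  by have := sqr_ge0 (y + y'); nra.
have sE : \sum_e dot (signs (flip_at k e)) v ^+ 2 = \sum_e dot (signs e) v ^+ 2.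
  by rewrite [RHS](reindex_inj (inv_inj (flip_atK k))).
rewrite big_split/= sE.
rewrite sumr_const -mulr_natl => h.
rewrite -(ler_pM2l (ltr0n R 2)); apply: le_trans (le_trans _ h) _; lra.
Qed.

End Rademacher.

Section Prior.
Context (R : realType) (m : nat).
Hypothesis m0 : (0 < m)%N.
Implicit Types (e : {ffun 'I_m -> bool}) (v : 'rV[R]_m) (A G : 'M[R]_m).

Local Notation N := (#|{ffun 'I_m -> bool}|%:R : R).

(** A union bound over the m coordinates of a contraction applied to random signs
    leaves a probability 1/16 of exceeding this threshold. *)
Definition sup_threshold : R := Num.sqrt (16 * ln (32 * m%:R)).

Definition good_signs A e : bool :=
  (m%:R / 8 <= dot (signs R e *m A) (signs R e *m A)) &&
  [forall k, `|(signs R e *m A) 0 k| <= sup_threshold].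

Lemma good_signs_flip A e : good_signs A (flip e) = good_signs A e.
Proof.
rewrite /good_signs signs_flip mulNmx; congr andb.
  by rewrite -scaleN1r dotZl dotZr mulrA mulN1r opprK mul1r.
by apply: eq_forallb => k; rewrite mxE normrN.
Qed.

(** The squared norm of signs * A is at most m, and its average is at least m / 4
    because of the diagonal of A; so it is at least m / 8 with probability 1/8. The
    sup norm fails to be small with probability at most 1/16. *)
Lemma good_signs_count A : A^T = A ->
  (forall u, dot (u *m A) (u *m A) <= dot u u) -> (forall j, 2^-1 <= A j j) ->
  N / 16 <= \sum_e (good_signs A e)%:R.
Proof.
move=> As A1 Ad; have mp : 0 < m%:R :> R by rewrite ltr0n.
have Np := card_signs_gt0 R m.
pose y e k := (signs R e *m A) 0 k.
pose row_ k : 'rV[R]_m := delta_mx 0 k *m A.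
have yE e k : y e k = dot (signs R e) (row_ k).
  by rewrite /row_ dotC dot_mulmx As dot_delta.
have row1 k : dot (row_ k) (row_ k) <= 1.
  by apply: le_trans (A1 _) _; rewrite dot_delta mxE !eqxx.
have rowd k : row_ k 0 k = A k k by rewrite /row_ -rowE mxE.
pose big e : R := (m%:R / 8 <= dot (signs R e *m A) (signs R e *m A))%R%:R.
pose bad e k : R := (sup_threshold < `|y e k|)%R%:R.
have goodE e : big e - \sum_k bad e k <= (good_signs A e)%:R.
  rewrite /big /bad /good_signs; case: (m%:R / 8 <= _) => /=; last first.
    by rewrite mulr0n sub0r oppr_le0 sumr_ge0.
  case: (boolP [forall k, `|(signs R e *m A) 0 k| <= sup_threshold]) => [_|/forallPn[k]].
    by rewrite mulr1n gerBl sumr_ge0.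
  rewrite -ltNge => kb; rewrite mulr1n mulr0n subr_le0 (bigD1 k)//= kb mulr1n.
  by rewrite lerDl sumr_ge0.
have bigN : N / 8 <= \sum_e big e.
  have h1 : N * (m%:R / 4) <= \sum_e dot (signs R e *m A) (signs R e *m A).
    rewrite /dot exchange_big /=.
    have -> : N * (m%:R / 4) = \sum_(k < m) N * (1 / 4).
      by rewrite sumr_const card_ord -mulr_natl; ring.
    apply: ler_sum => k _.
    rewrite (eq_bigr (fun e => dot (signs R e) (row_ k) ^+ 2)); last first.
      by move=> e _; rewrite -expr2 -yE.
    apply: le_trans (rademacher_second_moment (row_ k) k).
    by rewrite ler_pM2l// rowd; have := Ad k; nra.
  have h2 : \sum_e dot (signs R e *m A) (signs R e *m A) <=
      \sum_e (m%:R / 8 + m%:R * big e).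
    apply: ler_sum => e _; rewrite /big; case: (leP (m%:R / 8)) => /= h.
      by apply: le_trans (A1 _) _; rewrite dot_signs mulr1n mulr1; lra.
    by rewrite mulr0n mulr0 addr0 ltW.
  have := le_trans h1 h2.
  rewrite big_split/= sumr_const -mulr_sumr -[X in X + _]mulr_natl => h.
  rewrite -(ler_pM2l mp); lra.
have badN : \sum_e \sum_k bad e k <= N / 16.
  have l0 : 0 < ln (32 * m%:R) :> R.
    by rewrite ln_gt0// -natrM ltr1n (leq_trans _ (leq_mul (leqnn 32) m0)).
  have hh : sup_threshold ^+ 2 = 16 * ln (32 * m%:R).
    by rewrite sqr_sqrtr// mulr_ge0// ltW.
  (* The value of s that minimizes 4 s^2 - s * sup_threshold. *)
  pose s := sup_threshold / 8.
  have s0 : 0 <= s by rewrite divr_ge0 ?sqrtr_ge0.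
  have badle e k : bad e k <= expR (- (s * sup_threshold)) *
      (expR (s * dot (signs R e) (row_ k)) + expR (- s * dot (signs R e) (row_ k))).
    rewrite /bad -yE; case: (ltP sup_threshold) => /= h; rewrite ?mulr1n; last first.
      by rewrite mulr0n mulr_ge0 ?addr_ge0 ?expR_ge0.
    rewrite mulrDr -!expRD.
    have [y0|y0] := leP 0 (y e k).
      rewrite ger0_norm// in h; rewrite -[leLHS]addr0 lerD ?expR_ge0//.
      by rewrite -expR0 ler_expR; nra.
    rewrite ltr0_norm// in h; rewrite -[leLHS]add0r lerD ?expR_ge0//.
    by rewrite -expR0 ler_expR; nra.
  have one k : \sum_e bad e k <= N / (16 * m%:R).
    apply: (@le_trans _ _ (\sum_e expR (- (s * sup_threshold)) *
      (expR (s * dot (signs R e) (row_ k)) + expR (- s * dot (signs R e) (row_ k))))).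
      exact: ler_sum.
    rewrite -mulr_sumr big_split/=.
    have e1 := rademacher_mgf s (row_ k); have e2 := rademacher_mgf (- s) (row_ k).
    have e3 : expR (4 * s ^+ 2 * dot (row_ k) (row_ k)) <= expR (4 * s ^+ 2).
      by rewrite ler_expR ler_piMr// mulr_ge0 ?sqr_ge0.
    rewrite sqrrN in e2.
    apply: (@le_trans _ _ (expR (- (s * sup_threshold)) * (2 * (N * expR (4 * s ^+ 2))))).
      by rewrite ler_wpM2l ?expR_ge0//; nra.
    have -> : expR (- (s * sup_threshold)) * (2 * (N * expR (4 * s ^+ 2))) =
        2 * N * expR (- (s * sup_threshold) + 4 * s ^+ 2) by rewrite expRD; ring.
    have -> : - (s * sup_threshold) + 4 * s ^+ 2 = - ln (32 * m%:R).
      have -> : - (s * sup_threshold) + 4 * s ^+ 2 = - (sup_threshold ^+ 2 / 16).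
        by rewrite /s; field.
      by rewrite hh; field.
    rewrite expRN lnK ?posrE ?mulr_gt0//.
    rewrite le_eqVlt; apply/orP; left; apply/eqP; by field; rewrite gt_eqF.
  rewrite exchange_big /=.
  apply: (@le_trans _ _ (\sum_(k < m) N / (16 * m%:R))); first exact: ler_sum.
  rewrite sumr_const card_ord -mulr_natl.
  rewrite le_eqVlt; apply/orP; left; apply/eqP; by field; rewrite gt_eqF.
have : \sum_e (big e - \sum_k bad e k) <= \sum_e (good_signs A e)%:R.
  by apply: ler_sum => e _.
rewrite sumrB => /(le_trans _); apply; lra.
Qed.

(** The prior theta is uniform over the good signs, scaled by delta A. Since good
    signs are stable under negation, the average over f of exp x can be replaced by
    that of cosh x; as cosh x - 1 >= 0, restricting to good signs only decreases
    the sum, and the restriction costs the factor 16 through the normalization. *)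
Lemma rademacher_prior (G : 'M[R]_m) (lam delta : R) :
  G^T = G -> (forall u, 0 <= dot (u *m G) u) -> 0 < lam ->
  (forall j, G j j <= lam) -> 0 <= delta -> delta * sup_threshold <= 1 ->
  exists (w : {ffun 'I_m -> bool} -> R) (theta : {ffun 'I_m -> bool} -> 'rV[R]_m),
  [/\ forall e, 0 <= w e, \sum_e w e = 1, forall e k, `|theta e 0 k| <= 1,
     forall e, w e != 0 -> delta ^+ 2 * (m%:R / 8) <= dot (theta e) (theta e) &
     forall t, \sum_e \sum_f w e * w f * expR (t * dot (theta e *m G) (theta f)) <=
       1 + 16 * (expR (4 * t ^+ 2 * delta ^+ 4 * (lam ^+ 2 * m%:R)) - 1)].
Proof.
move=> Gs G0 lam0 Gl d0 dh; have [A [As A1 A2 Ad]] := resolvent Gs G0 lam0 Gl.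
have Np := card_signs_gt0 R m.
have cnt := good_signs_count As A1 Ad.
pose S : R := \sum_e (good_signs A e)%:R.
have Sp : 0 < S by apply: lt_le_trans cnt; rewrite divr_gt0.
pose w e : R := (good_signs A e)%:R / S.
pose theta e : 'rV[R]_m := if good_signs A e then delta *: (signs R e *m A) else 0.
have w1 : \sum_e w e = 1 by rewrite -mulr_suml mulfV// gt_eqF.
exists w, theta; split.
- by move=> e; rewrite divr_ge0// ltW.
- exact: w1.
- move=> e k; rewrite /theta; case: ifP => [/andP[_ /forallP/(_ k) h]|_].
    rewrite mxE normrM ger0_norm//; apply: le_trans dh.
    exact: ler_wpM2l.
  by rewrite mxE normr0.
- move=> e; rewrite /w /theta; case: ifP => [/andP[h _] _|_].
    by rewrite dotZl dotZr mulrA -expr2 ler_wpM2l// sqr_ge0.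
  by rewrite mulr0n mul0r eqxx.
move=> t.
pose B := expR (4 * t ^+ 2 * delta ^+ 4 * (lam ^+ 2 * m%:R)).
have dotE e f : good_signs A e -> good_signs A f ->
    t * dot (theta e *m G) (theta f) =
    t * delta ^+ 2 * dot (signs R f) (signs R e *m (A *m G *m A)).
  move=> ge gf; rewrite /theta ge gf -scalemxAl dotZl dotZr.
  by rewrite (dotC (signs R f)) !mulmxA (dot_mulmx _ _ A) As; ring.
have inner e : good_signs A e ->
    \sum_f (good_signs A f)%:R * expR (t * dot (theta e *m G) (theta f)) <=
    S + N * (B - 1).
  move=> ge; pose x f := t * delta ^+ 2 * dot (signs R f) (signs R e *m (A *m G *m A)).
  have xflip f : x (flip f) = - x f.
    by rewrite /x signs_flip -scaleN1r dotZl mulN1r mulrN.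
  have -> : \sum_f (good_signs A f)%:R * expR (t * dot (theta e *m G) (theta f)) =
      \sum_f (good_signs A f)%:R * expR (x f).
    apply: eq_bigr => f _; case: (boolP (good_signs A f)) => gf; last first.
      by rewrite !mulr0n !mul0r.
    by rewrite dotE.
  have sym (F : {ffun 'I_m -> bool} -> R) : \sum_f F (flip f) = \sum_f F f.
    by rewrite [RHS](reindex_inj (inv_inj (@flipK m))).
  have gx : \sum_f (good_signs A f)%:R * expR (x f) =
      \sum_f (good_signs A f)%:R * expR (- x f).
    rewrite -[LHS]sym; apply: eq_bigr => f _.
    by rewrite good_signs_flip xflip.
  have ax : \sum_f expR (x f) = \sum_f expR (- x f).
    by rewrite -[LHS]sym; apply: eq_bigr => f _; rewrite xflip.
  have mgf : \sum_f expR (x f) <= N * B.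
    apply: le_trans (rademacher_mgf _ _) _; rewrite ler_pM2l// ler_expR.
    have := A2 (signs R e); rewrite dot_signs => a2.
    have -> : 4 * t ^+ 2 * delta ^+ 4 * (lam ^+ 2 * m%:R) =
       4 * (t * delta ^+ 2) ^+ 2 * (lam ^+ 2 * m%:R) by ring.
    by rewrite ler_wpM2l// mulr_ge0// sqr_ge0.
  have cosh1 f : 0 <= expR (x f) + expR (- x f) - 2.
    by have := expR_ge1Dx (x f); have := expR_ge1Dx (- x f); lra.
  have : \sum_f (good_signs A f)%:R * (expR (x f) + expR (- x f) - 2) <=
      \sum_f (expR (x f) + expR (- x f) - 2).
    apply: ler_sum => f _; case: (good_signs A f); first by rewrite mulr1n mul1r.
    by rewrite mulr0n mul0r.
  have -> : \sum_f (good_signs A f)%:R * (expR (x f) + expR (- x f) - 2) =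
      \sum_f (good_signs A f)%:R * expR (x f) +
      \sum_f (good_signs A f)%:R * expR (- x f) - 2 * S.
    rewrite /S mulr_sumr -sumrN -!big_split/=; apply: eq_bigr => f _; ring.
  have -> : \sum_f (expR (x f) + expR (- x f) - 2) =
      \sum_f expR (x f) + \sum_f expR (- x f) - 2 * N.
    rewrite sumrB big_split/=; congr (_ - _).
    by rewrite sumr_const -[LHS]mulr_natr.
  rewrite -gx -ax => h.
  lra.
have B1 : 1 <= B.
  rewrite -expR0 ler_expR; apply: mulr_ge0; last first.
    by rewrite mulr_ge0 ?sqr_ge0.
  by apply: mulr_ge0; [rewrite mulr_ge0 ?sqr_ge0|exact: exprn_ge0].
have -> : \sum_e \sum_f w e * w f * expR (t * dot (theta e *m G) (theta f)) =
    \sum_e (w e / S) * \sum_f (good_signs A f)%:R *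
      expR (t * dot (theta e *m G) (theta f)).
  apply: eq_bigr => e _; rewrite mulr_sumr; apply: eq_bigr => f _.
  by rewrite /w; field; rewrite gt_eqF.
apply: (@le_trans _ _ (\sum_e (w e / S) * (S + N * (B - 1)))).
  apply: ler_sum => e _; rewrite /w; case: (boolP (good_signs A e)) => ge.
    by rewrite ler_wpM2l ?inner// mulr1n !divr_ge0// ltW.
  by rewrite mulr0n !mul0r.
rewrite -!mulr_suml mulfV ?gt_eqF// mul1r.
have -> : S^-1 * (S + N * (B - 1)) = 1 + N / S * (B - 1) by field; rewrite gt_eqF.
rewrite lerD2l ler_wpM2r ?subr_ge0// ler_pdivrMr//.
by move: cnt; rewrite -/S; lra.
Qed.

End Prior.

(** * Moving mass inside pairs of cells *)

Section Pairs.
Context (R : realType) (k : nat).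
Local Notation m := k./2.
Implicit Types (th : 'rV[R]_m) (H : 'I_k -> 'I_k -> R).

Lemma lo_subproof (l : 'I_m) : (l.*2 < k)%N.
Proof. by have := ltn_ord l; lia. Qed.

Lemma hi_subproof (l : 'I_m) : (l.*2.+1 < k)%N.
Proof. by have := ltn_ord l; lia. Qed.

Definition lo (l : 'I_m) : 'I_k := Ordinal (lo_subproof l).
Definition hi (l : 'I_m) : 'I_k := Ordinal (hi_subproof l).

(** The vector that adds mass to the even cell of the pair l and removes it from
    the odd one; when k is odd the last cell is left alone. *)
Definition pairing (l : 'I_m) (j : 'I_k) : R := (-1) ^+ odd j *+ (j./2 == l).

Definition pair_spread th (j : 'I_k) : R := \sum_l th 0 l * pairing l j.

Lemma pairing_sum (F : 'I_k -> R) l : \sum_j pairing l j * F j = F (lo l) - F (hi l).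
Proof.
rewrite (bigD1 (lo l))//= (bigD1 (hi l))//=; last first.
  by rewrite -val_eqE/=; lia.
rewrite {1 2}/pairing /= doubleK odd_double uphalf_double eqxx /= !mulr1n.
rewrite expr0 expr1 mul1r mulN1r big1 ?addr0// => j /andP[].
rewrite -!val_eqE/= => j1 j2; rewrite /pairing.
have -> : (j./2 == l) = false by lia.
by rewrite mulr0n mul0r.
Qed.

Lemma pair_spread_lo th l : pair_spread th (lo l) = th 0 l.
Proof.
rewrite /pair_spread (bigD1 l)//= /pairing /= doubleK eqxx odd_double mulr1n.
rewrite mulr1 big1 ?addr0//.
by move=> i /negbTE il; rewrite val_eqE eq_sym il mulr0n mulr0.
Qed.

Lemma pair_spread_hi th l : pair_spread th (hi l) = - th 0 l.
Proof.
rewrite /pair_spread (bigD1 l)//= /pairing /= uphalf_double eqxx odd_double expr1 mulr1n.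
rewrite mulrN1 big1 ?addr0// => i /negbTE il.
by rewrite val_eqE eq_sym il mulr0n mulr0.
Qed.

Lemma pair_spread_sum th (F : 'I_k -> R) :
  \sum_j pair_spread th j * F j = \sum_l th 0 l * (F (lo l) - F (hi l)).
Proof.
under eq_bigr do rewrite /pair_spread mulr_suml.
rewrite exchange_big; apply: eq_bigr => l _ /=.
by rewrite -pairing_sum mulr_sumr; apply: eq_bigr => j _; rewrite mulrA.
Qed.

Lemma pair_spread_sum0 th : \sum_j pair_spread th j = 0.
Proof.
have := pair_spread_sum th (fun=> 1); under eq_bigr do rewrite mulr1.
by move=> ->; rewrite big1// => l _; rewrite subrr mulr0.
Qed.

Lemma pair_spread_sqr th : \sum_j pair_spread th j ^+ 2 = 2 * dot th th.
Proof.
rewrite (eq_bigr (fun j => pair_spread th j * pair_spread th j)); last first.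
  by move=> j _; rewrite expr2.
rewrite pair_spread_sum /dot mulr_sumr; apply: eq_bigr => l _.
by rewrite pair_spread_lo pair_spread_hi; ring.
Qed.

Lemma pair_spread_ge th j : (forall l, `|th 0 l| <= 1) -> -1 <= pair_spread th j.
Proof.
move=> th1; case: (ltnP j./2 m) => jm; last first.
  rewrite /pair_spread big1 ?lerN10// => l _; rewrite /pairing.
  have -> : (j./2 == l) = false by have := ltn_ord l; lia.
  by rewrite mulr0n mulr0.
have := th1 (Ordinal jm); rewrite ler_norml => /andP[h1 h2].
have [oj|ej] := boolP (odd j).
  have -> : j = hi (Ordinal jm) by apply: val_inj => /=; lia.
  by rewrite pair_spread_hi; lra.
have -> : j = lo (Ordinal jm) by apply: val_inj => /=; lia.
by rewrite pair_spread_lo; lra.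
Qed.

Definition pair_gram H : 'M[R]_m :=
  \matrix_(l, l') (H (lo l) (lo l') - H (lo l) (hi l') -
    (H (hi l) (lo l') - H (hi l) (hi l'))).

Lemma bilin_pair_spread H th th' :
  bilin H (pair_spread th) (pair_spread th') = dot (th *m pair_gram H) th'.
Proof.
transitivity (\sum_i pair_spread th i * \sum_j pair_spread th' j * H i j).
  apply: eq_bigr => i _; rewrite mulr_sumr; apply: eq_bigr => j _; ring.
rewrite pair_spread_sum.
under eq_bigr => l _ do rewrite !pair_spread_sum -sumrB mulr_sumr.
rewrite exchange_big; apply: eq_bigr => l' _ /=.
rewrite mxE mulr_suml; apply: eq_bigr => l _; rewrite mxE; ring.
Qed.

End Pairs.

Section PrivateRate.
Context (R : realType) (n k : nat) (Q : channel R n) (alpha gamma beta delta : R).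

(** The amplitudes are those of [rademacher_prior] for the pair Gram matrix summed
    over the coordinates, whose diagonal is at most n z_alpha^2. *)
Lemma private_rate_ge Delta : (0 < n)%N -> (1 < k)%N -> 0 < alpha ->
  private alpha Q -> gamma + beta < 1 ->
  0 <= delta -> delta * sup_threshold R k./2 <= 1 ->
  16 * (expR (4 * (k%:R ^- 2) ^+ 2 * delta ^+ 4 *
        ((n%:R * z_ alpha ^+ 2) ^+ 2 * k./2%:R)) - 1) <=
    ((1 - gamma - beta) / 2) ^+ 2 ->
  level_test gamma (unif_density R) Q Delta ->
  ((delta / 4)%:E <= test_rate Delta (piecewise_const k) beta (unif_density R))%E.
Proof.
move=> n0 k1 al0 priv gb d0 dh chi lev.
have k0 : (0 < k)%N by lia.
have m0 : (0 < k./2)%N by lia.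
have k4m : (k <= 4 * k./2)%N by lia.
have [H Hg HQ] := gram_controls_private k0 (ltW al0) priv.
have z0 : 0 < z_ alpha by rewrite /z_ subr_gt0 ltr_expR; lra.
have np : 0 < n%:R :> R by rewrite ltr0n.
have kp : 0 < k%:R :> R by rewrite ltr0n.
pose lam := n%:R * z_ alpha ^+ 2.
have lam0 : 0 < lam by rewrite mulr_gt0// exprn_gt0.
pose G : 'M[R]_(k./2) := \sum_i pair_gram (H i).
have GE th th' : dot (th *m G) th' =
    \sum_i bilin (H i) (pair_spread th) (pair_spread th').
  rewrite dotE mulmx_sumr mulmx_suml summxE; apply: eq_bigr => i _.
  by rewrite bilin_pair_spread dotE.
have Gs : G^T = G.
  rewrite /G linear_sum/=; apply: eq_bigr => i _; apply/matrixP => l l'.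
  by have [_ Hs _ _ _] := Hg i; rewrite !mxE !(Hs _ (lo l')) !(Hs _ (hi l')); ring.
have G0 u : 0 <= dot (u *m G) u.
  by rewrite GE; apply: sumr_ge0 => i _; have [_ _ _ psd _] := Hg i; exact: psd.
have Gl l : G l l <= lam.
  rewrite /G summxE /lam -[n in n%:R]card_ord -sum1_card natr_sum mulr_suml.
  apply: ler_sum => i _; have [_ Hs _ _ Hd] := Hg i; rewrite mul1r.
  by apply: le_trans (Hd (lo l) (hi l)); rewrite mxE (Hs (hi l)); lra.
have [w [th [w0 w1 th1 thw chiw]]] := rademacher_prior m0 Gs G0 lam0 Gl d0 dh.
have sp e : is_prob (tilt (pair_spread (th e))).
  apply: tilt_prob => //; first exact: pair_spread_sum0.
  by move=> j; exact: pair_spread_ge (th1 e).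
apply: (@test_rate_ge _ _ _ _ k0 _ HQ _ w _ sp gamma beta _ Delta w0 w1 gb _ _ lev)
  => [e we|].
  apply: L2dist_tilt => //; first by rewrite divr_ge0.
  have := thw e we; rewrite pair_spread_sqr => h.
  have mk : k%:R <= 4 * k./2%:R :> R by rewrite -natrM ler_nat.
  rewrite ler_pdivlMl//.
  have := sqr_ge0 delta; nra.
apply: le_trans chi; rewrite lerBlDl; apply: le_trans (chiw (k%:R ^- 2)).
apply: ler_sum => e _; apply: ler_sum => f _; apply: ler_wpM2l; first exact: mulr_ge0.
rewrite GE mulr_sumr; apply: prod_le_expR_sum => i.
  by apply: bilin_ge0 => //; case: (Hg i).
have [_ Hs Hr _ _] := Hg i.
by rewrite bilin_tilt//; exact: pair_spread_sum0.
Qed.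

End PrivateRate.

(** * Choice of the parameters *)

Lemma sqr_powR (R : realType) (a r : R) : (a `^ r) ^+ 2 = a `^ (r * 2).
Proof. by rewrite powRrM (powR_mulrn 2)// powR_ge0. Qed.

Lemma sqr_powR_Nhalf (R : realType) (a : R) : 0 <= a -> (a `^ (- 2^-1)) ^+ 2 = a^-1.
Proof. by move=> a0; rewrite sqr_powR mulNr mulVf// powR_inv1. Qed.

Lemma half_bounds d : (1 < d)%N -> (0 < d./2)%N /\ (d./2 * 2 <= d)%N.
Proof. by move=> d1; split; lia. Qed.

(** The group size g is the integer part of sqrt (2 d). *)
Lemma group_split d : (1 < d)%N -> exists m g,
  [/\ (1 < g)%N, (g * g <= 2 * d)%N, (d <= 4 * (g * g))%N, (m * g <= d)%N &
      (d <= 2 * (m * g))%N].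
Proof.
move=> d1.
have ex : exists g, (g * g <= 2 * d)%N by exists 2%N; lia.
have bd g : (g * g <= 2 * d)%N -> (g <= 2 * d)%N by nia.
have [g gle gmax] := ex_maxnP ex bd.
have g2 : (1 < g)%N by apply: gmax; lia.
have d4 : (d <= 4 * (g * g))%N.
  have [/gmax|lt] := leqP (g.+1 * g.+1) (2 * d); first by lia.
  nia.
have m0 : (0 < d %/ g)%N by rewrite divn_gt0; nia.
have lt : (d %% g < g)%N by rewrite ltn_mod; lia.
exists (d %/ g)%N, g; split=> //; first exact: leq_trunc_div.
have dE := divn_eq d g; move: (d %/ g)%N (d %% g)%N m0 lt dE => m r m0 lt dE; nia.
Qed.

Section Final.
Context (R : realType) (gamma beta : R).
Hypothesis gb : gamma + beta < 1.

Let D := (1 - gamma - beta) / 2.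
Let s0 := ln (1 + D ^+ 2 / 16).
(** The bound s0 / 2 serves both chi-square conditions: exp s0 - 1 = D^2 / 16,
    and the exponents that occur are at most 2 kappa. The bound 1 / 9 makes
    80 kappa^2 <= 1, which keeps the perturbed densities nonnegative. *)
Definition kappa : R := Num.min 9^-1 (s0 / 2).

Let D0 : 0 < D. Proof. by move: gb; rewrite /D; lra. Qed.
Let s0_gt0 : 0 < s0.
Proof. by rewrite ln_gt0// ltrDl divr_gt0// exprn_gt0. Qed.
Let expR_s0 : expR s0 = 1 + D ^+ 2 / 16.
Proof. by rewrite lnK// posrE addr_gt0// divr_gt0// exprn_gt0. Qed.

Lemma kappa_gt0 : 0 < kappa.
Proof. by rewrite /kappa lt_min invr_gt0 ltr0n divr_gt0. Qed.
Let k9 : kappa <= 9^-1. Proof. by rewrite /kappa ge_min lexx. Qed.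
Let ks : 2 * kappa <= s0.
Proof.
have : kappa <= s0 / 2 by rewrite /kappa ge_min lexx orbT.
lra.
Qed.
Let k0 := kappa_gt0.

Lemma private_bound (alpha : R) n d (Q : channel R n) Delta :
  0 < alpha -> (0 < n)%N -> (1 < d)%N -> private alpha Q ->
  level_test gamma (unif_density R) Q Delta ->
  ((kappa / 4 * (Num.min ((n%:R * z_ alpha ^+ 2) `^ (- 2^-1) * d%:R `^ (4^-1))
     (d%:R `^ (- 2^-1) * (ln d%:R) `^ (- 2^-1)) * d%:R `^ (2^-1)))%:E <=
   test_rate Delta (piecewise_const d) beta (unif_density R))%E.
Proof.
move=> al0 n0 d1 priv lev; have [k0' k9' ks'] := And3 k0 k9 ks.
have z0 : 0 < z_ alpha by rewrite /z_ subr_gt0 ltr_expR; lra.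
have np : 0 < n%:R :> R by rewrite ltr0n.
have dp : 0 < d%:R :> R by rewrite ltr0n ltnW.
set lam := n%:R * z_ alpha ^+ 2.
have lam0 : 0 < lam by rewrite mulr_gt0// exprn_gt0.
set u := lam `^ (- 2^-1) * d%:R `^ (4^-1).
set v := d%:R `^ (- 2^-1) * (ln d%:R) `^ (- 2^-1); set sq := (d%:R : R) `^ (2^-1).
have L0 : 0 < ln d%:R :> R by rewrite ln_gt0// ltr1n.
have u0 : 0 <= u by rewrite mulr_ge0 ?powR_ge0.
have v0 : 0 <= v by rewrite mulr_ge0 ?powR_ge0.
have sq0 : 0 <= sq by exact: powR_ge0.
have sq2 : sq ^+ 2 = d%:R by rewrite /sq sqr_powR mulVf// powRr1// ltW.
have u2 : u ^+ 2 = lam^-1 * sq.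
  rewrite /u exprMn sqr_powR_Nhalf ?ltW//; congr (_ * _); rewrite sqr_powR /sq.
  by congr (_ `^ _); field.
have v2 : v ^+ 2 = d%:R^-1 * (ln d%:R)^-1.
  by rewrite /v exprMn !sqr_powR_Nhalf ?ltW.
set mn := Num.min u v.
have mn0 : 0 <= mn by rewrite le_min u0 v0.
have mnu : mn <= u by rewrite ge_min lexx.
have mnv : mn <= v by rewrite ge_min lexx orbT.
have mnu2 : mn ^+ 2 <= lam^-1 * sq by rewrite -u2 ler_sqr ?nnegrE.
have mnv2 : mn ^+ 2 <= d%:R^-1 * (ln d%:R)^-1 by rewrite -v2 ler_sqr ?nnegrE.
have -> : kappa / 4 * (mn * sq) = (kappa * mn * sq) / 4 by ring.
have dl0 : 0 <= kappa * mn * sq by rewrite !mulr_ge0// ltW.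
have [h0 h2] := half_bounds d1.
have m2 : d./2%:R * 2 <= d%:R :> R by rewrite -natrM ler_nat.
have m1 : 1 <= d./2%:R :> R by rewrite ler1n.
apply: (private_rate_ge n0 d1 al0 priv gb dl0 _ _ lev).
  have ht0 : 0 <= sup_threshold R d./2 by exact: sqrtr_ge0.
  (* 32 (d / 2) <= 16 d <= d^5. *)
  have l32 : ln (32 * d./2%:R) <= 5 * ln d%:R :> R.
    have -> : 5 * ln d%:R = ln (d%:R ^+ 5) :> R by rewrite lnXn// mulr_natl.
    rewrite ler_ln ?posrE ?exprn_gt0//; last by lra.
    have d2 : 2 <= d%:R :> R by rewrite ler_nat.
    have d4 : 16 <= d%:R ^+ 4 :> R.
      by rewrite (_ : 16 = 2 ^+ 4 :> R) ?lerXn2r ?nnegrE ?ler0n// -natrX.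
    by rewrite exprS; nra.
  have l0 : 0 <= ln (32 * d./2%:R) :> R by rewrite ln_ge0//; lra.
  rewrite -(@ler_sqr R) ?nnegrE//; last by rewrite mulr_ge0.
  rewrite expr1n exprMn sqr_sqrtr; last by rewrite mulr_ge0.
  rewrite !exprMn sq2.
  have e1 : mn ^+ 2 * d%:R <= (ln d%:R)^-1.
    by rewrite -ler_pdivlMr// mulrC.
  have e2 : mn ^+ 2 * d%:R * ln d%:R <= 1 by rewrite -ler_pdivlMr// div1r.
  have e3 : 0 <= mn ^+ 2 * d%:R by rewrite mulr_ge0 ?sqr_ge0// ltW.
  have e4 : kappa ^+ 2 <= 81^-1 by nra.
  have e5 : mn ^+ 2 * d%:R * (16 * ln (32 * d./2%:R)) <= 80 by nra.
  have e6 : 0 <= mn ^+ 2 * d%:R * (16 * ln (32 * d./2%:R)).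
    by rewrite mulr_ge0// mulr_ge0.
  rewrite [leLHS](_ : _ = kappa ^+ 2 * (mn ^+ 2 * d%:R * (16 * ln (32 * d./2%:R)))).
    by have := sqr_ge0 kappa; nra.
  by ring.
set s := (X in expR X).
have : s <= s0.
  have e1 : (mn ^+ 2) ^+ 2 <= (lam^-1 * sq) ^+ 2.
    by rewrite ler_sqr ?nnegrE ?sqr_ge0// mulr_ge0// invr_ge0 ltW.
  have sE : s = 4 * kappa ^+ 4 * (lam ^+ 2 * (mn ^+ 2) ^+ 2) * d./2%:R / d%:R ^+ 2.
    rewrite /s -/lam -sq2; have sqn : sq != 0 by rewrite -sqrf_eq0 sq2 gt_eqF.
    by field.
  have e2 : lam ^+ 2 * (mn ^+ 2) ^+ 2 <= d%:R.
    rewrite -sq2; apply: (@le_trans _ _ (lam ^+ 2 * (lam^-1 * sq) ^+ 2)).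
      by rewrite ler_wpM2l ?sqr_ge0.
    by rewrite le_eqVlt; apply/orP; left; apply/eqP; field; rewrite gt_eqF.
  have e3 : kappa ^+ 4 <= kappa.
    by rewrite exprS ler_piMr ?exprn_ile1// ltW//; lra.
  have e4 : 0 <= kappa ^+ 4 by rewrite exprn_ge0 ?ltW.
  rewrite sE ler_pdivrMr ?exprn_gt0//.
  have e5 : 0 <= lam ^+ 2 * (mn ^+ 2) ^+ 2 by rewrite mulr_ge0 ?sqr_ge0.
  have e6 : lam ^+ 2 * (mn ^+ 2) ^+ 2 * d./2%:R <= d%:R * (d%:R / 2) by nra.
  have e7 : 0 <= lam ^+ 2 * (mn ^+ 2) ^+ 2 * d./2%:R by rewrite mulr_ge0.
  rewrite -[leLHS]mulrA; have := sqr_ge0 (d%:R : R); nra.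
by rewrite -ler_expR expR_s0 -/D; lra.
Qed.

Lemma nonprivate_bound n d (Q : channel R n) Delta :
  (0 < n)%N -> (1 < d)%N -> level_test gamma (unif_density R) Q Delta ->
  ((kappa / 4 * ((n%:R `^ (- 2^-1) * d%:R `^ (- 4^-1)) * d%:R `^ (2^-1)))%:E <=
   test_rate Delta (piecewise_const d) beta (unif_density R))%E.
Proof.
move=> n0 d1 lev; have [k0' k9' ks'] := And3 k0 k9 ks.
have np : 1 <= n%:R :> R by rewrite ler1n.
have np0 : 0 < n%:R :> R by rewrite ltr0n.
have dp : 0 < d%:R :> R by rewrite ltr0n ltnW.
set sq := (d%:R : R) `^ (2^-1).
have sq0 : 0 < sq by exact: powR_gt0.
have sq2 : sq ^+ 2 = d%:R by rewrite /sq sqr_powR mulVf// powRr1// ltW.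
set x := n%:R `^ (- 2^-1) * d%:R `^ (- 4^-1).
have x0 : 0 <= x by rewrite mulr_ge0 ?powR_ge0.
have x2 : x ^+ 2 = n%:R^-1 * sq^-1.
  rewrite /x exprMn sqr_powR_Nhalf ?ltW//; congr (_ * _); rewrite sqr_powR /sq -powRN.
  by congr (_ `^ _); field.
have [m [g [g1 g2 g4 mg mg2]]] := group_split d1.
pose delta : R := Num.sqrt (kappa / n%:R).
have d2 : delta ^+ 2 = kappa / n%:R by rewrite sqr_sqrtr// divr_ge0// ltW.
have g2R : g%:R * g%:R <= 2 * d%:R :> R by rewrite -!natrM ler_nat.
have g4R : d%:R <= 4 * (g%:R * g%:R) :> R by rewrite -!natrM ler_nat.
have mg2R : d%:R <= 2 * (m%:R * g%:R) :> R by rewrite -!natrM ler_nat.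
have gR : 2 <= g%:R :> R by rewrite ler_nat.
have tauE : n%:R * (d%:R^-1 * delta ^+ 2 * g%:R) = kappa * g%:R / d%:R.
  by rewrite d2; field; rewrite !gt_eqF.
apply: (@data_rate_ge R n d m g Q gamma beta delta _ Delta) => //.
- exact: ltnW.
- exact: ltnW.
- rewrite sqrtr_ge0/= -(@ler_sqr R) ?nnegrE ?sqrtr_ge0// d2 expr1n ler_pdivrMr//; lra.
- rewrite tauE mulrAC ler_pdivrMr//; nra.
- rewrite tauE.
  have : d%:R * (kappa * g%:R / d%:R) ^+ 2 <= s0.
    have -> : d%:R * (kappa * g%:R / d%:R) ^+ 2 = kappa ^+ 2 * (g%:R * g%:R) / d%:R.
      by field; rewrite gt_eqF.
    have k2 : kappa ^+ 2 * 2 <= s0 by nra.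
    rewrite ler_pdivrMr//; apply: (@le_trans _ _ (kappa ^+ 2 * (2 * d%:R))).
      by rewrite ler_wpM2l ?sqr_ge0.
    by rewrite mulrA ler_wpM2r// ltW.
  by rewrite -ler_expR expR_s0 -/D; have := sqr_ge0 D; lra.
- by apply: mulr_ge0; [rewrite divr_ge0 ?ler0n ?ltW|apply: mulr_ge0 => //; exact: ltW].
have -> : (kappa / 4 * (x * sq)) ^+ 2 = (kappa / 4) ^+ 2 * (x ^+ 2 * sq ^+ 2) by ring.
rewrite x2 d2.
have sqg : sq <= 2 * g%:R.
  by rewrite -(@ler_sqr R) ?nnegrE ?(ltW sq0) ?mulr_ge0// sq2; nra.
have -> : (kappa / 4) ^+ 2 * (n%:R^-1 * sq^-1 * sq ^+ 2) =
  (kappa / n%:R) * (kappa * sq / 16).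
  by field; rewrite !gt_eqF.
have -> : d%:R^-1 * (kappa / n%:R * g%:R * (m%:R * (g%:R - 1))) =
  (kappa / n%:R) * (d%:R^-1 * (m%:R * g%:R * (g%:R - 1))) by ring.
apply: ler_wpM2l; first by rewrite divr_ge0 ?ler0n ?ltW.
rewrite ler_pdivlMl//.
have gg : g%:R <= 2 * (g%:R - 1) :> R by lra.
have kg : kappa * sq / 16 <= (g%:R - 1) / 2.
  have : kappa * sq <= 9^-1 * sq by rewrite ler_wpM2r// ltW.
  lra.
apply: (@le_trans _ _ (d%:R * ((g%:R - 1) / 2))).
  by apply: ler_wpM2l; [exact: ltW|].
have -> : d%:R * ((g%:R - 1) / 2) = (d%:R / 2) * (g%:R - 1) :> R by ring.
by apply: ler_wpM2r; lra.
Qed.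

End Final.

Theorem theorem3p2 (R : realType) (gamma beta : R)
    (gamma01 : 0 < gamma < 1) (beta01 : 0 < beta < 1)
    (gamma_beta : 2 * gamma + beta < 1) :
  exists c : R, 0 < c /\
    forall (alpha : R) (n d : nat), 0 < alpha -> (1 <= n)%N -> (2 <= d)%N ->
      ((c * Num.max
              (Num.min ((n%:R * z_ alpha ^+ 2) `^ (- 2^-1) * d%:R `^ (4^-1))
                       (d%:R `^ (- 2^-1) * (ln d%:R) `^ (- 2^-1)))
              (n%:R `^ (- 2^-1) * d%:R `^ (- 4^-1)))%:E
       <= minimax_rate n (piecewise_const d) alpha gamma beta (unif_density R)
          / (d%:R `^ (2^-1))%:E)%E.
Proof.
have gb : gamma + beta < 1 by case/andP: gamma01 => ? _; lra.
exists (kappa gamma beta / 4); split; first by rewrite divr_gt0 ?kappa_gt0.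
move=> alpha n d al0 n0 d1.
have sq0 : 0 < d%:R `^ (2^-1) :> R by rewrite powR_gt0// ltr0n (leq_trans _ d1).
rewrite inver gt_eqF// lee_pdivlMr// -EFinM.
apply/ereal_infP => _ [Q priv ->]; apply/ereal_infP => _ [Delta lev <-].
rewrite maxEle -(mulrA (_ / 4)); case: ifP => _.
  exact: nonprivate_bound.
exact: private_bound.
Qed.
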